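(* Let $A\subseteq \mathrm{SB}$ be an analytic set such that every $X\in A$ has separable dual $X^*$. Then the set $$A^*=\{Y\in \mathrm{SB}: \exists X\in A \text{ with } Y\cong X^*\}$$ is an analytic subset of $\mathrm{SB}$.
   Context: $C(2^{\mathbb{N}})$ is the Banach space of continuous real-valued functions on the Cantor set $2^{\mathbb{N}}$ with the supremum norm. $\mathrm{SB}$ denotes the set of all closed linear subspaces of $C(2^{\mathbb{N}})$, endowed with the relative Effros-Borel structure, i.e. the $\sigma$-algebra generated by the sets $\{X\in\mathrm{SB}: X\cap U\neq\varnothing\}$, with $U$ ranging over the open subsets of $C(2^{\mathbb{N}})$. With this structure $\mathrm{SB}$ is a standard Borel space, and every separable Banach space is isometric to a member of $\mathrm{SB}$. A class of separable Banach spaces is identified with a subset of $\mathrm{SB}$. $X\cong Y$ means that $X$ and $Y$ are linearly isomorphic (i.e. there is a linear homeomorphism between them). A subset of a standard Borel space is analytic if it is the image of a standard Borel space under a Borel map. *)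

(* Defs.v *)
From HB Require Import structures.
From mathcomp Require Import all_boot all_order all_algebra.
From mathcomp Require Import all_classical all_reals all_analysis.

Set Implicit Arguments.
Unset Strict Implicit.
Unset Printing Implicit Defensive.

Import Order.TTheory GRing.Theory Num.Theory.
Import numFieldNormedType.Exports.

Local Open Scope classical_set_scope.
Local Open Scope ring_scope.

Definition separable (T : topologicalType) : Prop :=
  exists2 D : set T, countable D & dense D.

Definition borel (T : topologicalType) : set (set T) := <<s @open T >>.

Definition complete_space (P : uniformType) : Prop :=
  forall F : set_system P, ProperFilter F -> cauchy F -> exists l : P, F --> l.

(* (X, S) is Borel isomorphic to a complete separable metric space. [X] is a bare
type with a set system rather than a [measurableType], and [P] is not a
[completePseudoMetricType], because those structures are pointed: without the
empty space, the empty set would not be analytic. *)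
Definition standard_borel (R : realType) (X : Type) (S : set (set X)) : Prop :=
  exists (P : metricType R) (h : P -> X),
    [/\ separable P, complete_space P, bijective h &
        forall B : set X, S B <-> borel (h @^-1` B)].

Definition analytic (R : realType) d (T : measurableType d) (A : set T) : Prop :=
  exists (X : Type) (S : set (set X)) (f : X -> T),
    [/\ standard_borel R S,
        (forall B : set T, measurable B -> S (f @^-1` B)) &
        A = range f].

Section sup_abs.
Context {R : realType} {T : Type}.
Implicit Types (D : set T) (f g : T -> R).

Definition sup_abs D f : R := sup [set `|f x| | x in D].

Lemma sup_abs_ge D f x :
  has_ubound [set `|f x| | x in D] -> D x -> `|f x| <= sup_abs D f.
Proof. by move=> fD Dx; apply: ub_le_sup => //; exists x. Qed.

Lemma sup_abs_le D f (M : R) :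
  D !=set0 -> (forall x, D x -> `|f x| <= M) -> sup_abs D f <= M.
Proof.
move=> [x0 Dx0] fM; apply: ge_sup; first by exists `|f x0|, x0.
by move=> _ [x Dx <-]; exact: fM.
Qed.

Lemma sup_absD D f g : D !=set0 ->
  has_ubound [set `|f x| | x in D] -> has_ubound [set `|g x| | x in D] ->
  sup_abs D (f + g) <= sup_abs D f + sup_abs D g.
Proof.
move=> D0 fD gD; apply: sup_abs_le => // x Dx.
by rewrite (le_trans (ler_normD _ _))// lerD// sup_abs_ge.
Qed.

Lemma sup_absZ D f (a : R) : D !=set0 ->
  has_ubound [set `|f x| | x in D] ->
  sup_abs D (a *: f) = `|a| * sup_abs D f.
Proof.
move=> D0 fD.
have leaf (b : R) (g : T -> R) : has_ubound [set `|g x| | x in D] ->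
    sup_abs D (b *: g) <= `|b| * sup_abs D g.
  move=> gD; apply: sup_abs_le => // x Dx.
  by rewrite [X in `|X|]/(_ * _) normrM ler_wpM2l// sup_abs_ge.
apply/eqP; rewrite eq_le leaf//=.
have [->|a0] := eqVneq a 0.
  rewrite normr0 mul0r; case: D0 => x Dx.
  apply: le_trans (normr_ge0 ((0 *: f) x)) _; apply: sup_abs_ge => //.
  by exists 0 => _ [y _ <-]; rewrite scale0r /= normr0.
rewrite -ler_pdivlMl ?normr_gt0// -normfV.
rewrite -[in leLHS](scalerK a0 f); apply: leaf.
case: fD => M fM; exists (`|a| * M) => _ [x Dx <-].
rewrite [X in `|X|]/(_ * _) normrM ler_wpM2l//; apply: fM; by exists x.
Qed.

End sup_abs.

Section C2N.
Variable R : realType.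

Definition ctsfun : {pred (cantor_space -> R)} :=
  mem [set f : cantor_space -> R | continuous f].

Fact ctsfun_submod_closed : submod_closed ctsfun.
Proof.
split; first by rewrite inE => x; exact: cst_continuous.
move=> a f g; rewrite !inE => fc gc x.
by apply: (@continuousD R R^o); [apply: continuousZr|exact: gc] => //; exact: fc.
Qed.

HB.instance Definition _ :=
  GRing.isSubmodClosed.Build R (cantor_space -> R) ctsfun ctsfun_submod_closed.

Definition C2N : Type := {f : cantor_space -> R | f \in ctsfun}.

HB.instance Definition _ := SubChoice.on C2N.
HB.instance Definition _ := [SubChoice_isSubLmodule of C2N by <:].

Definition C2N_fun (f : C2N) : cantor_space -> R := val f.
Coercion C2N_fun : C2N >-> Funclass.

Lemma C2N_ubound (f : C2N) : has_ubound [set `|f x| | x in setT].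
Proof.
have fc : continuous f by have := valP f; rewrite inE.
have /compact_bounded[M [_ fM]] : compact (f @` setT).
  apply: continuous_compact; last exact: cantor_space_compact.
  exact: continuous_subspaceT.
exists (M + 1) => _ [x _ <-]; apply: (fM (M + 1)); first by rewrite ltrDl.
by exists x.
Qed.

Let norm (f : C2N) : R := sup_abs setT f.

Let T0 : [set: cantor_space] !=set0. Proof. by exists point. Qed.

Let normD (f g : C2N) : norm (f + g) <= norm f + norm g.
Proof. by apply: sup_absD => //; exact: C2N_ubound. Qed.

Let normZ (a : R) (f : C2N) : norm (a *: f) = `|a| * norm f.
Proof. by apply: sup_absZ => //; exact: C2N_ubound. Qed.

Let norm0_eq0 (f : C2N) : norm f = 0 -> f = 0.
Proof.
move=> f0; apply/val_inj/funext => x; apply/normr0_eq0/eqP.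
rewrite eq_le normr_ge0 andbT -[leRHS]f0.
by apply: sup_abs_ge => //; exact: C2N_ubound.
Qed.

HB.instance Definition _ :=
  Lmodule_isNormed.Build R C2N normD normZ norm0_eq0.

Lemma C2N_normE (f : C2N) : `|f| = sup [set `|f x| | x in setT].
Proof. by []. Qed.

End C2N.

Section closed_subspace.
Context {R : realType} {V : normedModType R}.

Record closedSubspace := ClosedSubspace {
  subspace_set :> set V ;
  subspace_closed : closed subspace_set ;
  subspace_submod : submod_closed (mem subspace_set) }.

HB.instance Definition _ := gen_eqMixin closedSubspace.
HB.instance Definition _ := gen_choiceMixin closedSubspace.

Fact zero_subspace_closed : closed [set 0 : V].
Proof.
by apply: accessible_closed_set1; apply: hausdorff_accessible;
  exact: norm_hausdorff.
Qed.

Fact zero_subspace_submod : submod_closed (mem [set 0 : V]).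
Proof.
split; first by rewrite inE.
by move=> a u v; rewrite !inE => -> ->; rewrite scaler0 addr0.
Qed.

HB.instance Definition _ := isPointed.Build closedSubspace
  (ClosedSubspace zero_subspace_closed zero_subspace_submod).

Definition subspace_pred (X : closedSubspace) : {pred V} := mem (X : set V).

HB.instance Definition _ (X : closedSubspace) :=
  GRing.isSubmodClosed.Build R V (subspace_pred X) (subspace_submod X).

Definition subspace_space (X : closedSubspace) : Type :=
  {x : V | x \in subspace_pred X}.

Section instances.
Variable X : closedSubspace.

HB.instance Definition _ := SubChoice.on (subspace_space X).
HB.instance Definition _ := [SubChoice_isSubLmodule of subspace_space X by <:].

Let norm (x : subspace_space X) : R := `|val x|.

Let normD x y : norm (x + y) <= norm x + norm y.
Proof. exact: ler_normD. Qed.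

Let normZ (a : R) x : norm (a *: x) = `|a| * norm x.
Proof. exact: normrZ. Qed.

Let norm0_eq0 x : norm x = 0 -> x = 0.
Proof. by move=> /normr0_eq0 x0; exact: val_inj. Qed.

HB.instance Definition _ :=
  Lmodule_isNormed.Build R (subspace_space X) normD normZ norm0_eq0.

Lemma subspace_normE (x : subspace_space X) : `|x| = `|val x|.
Proof. by []. Qed.

End instances.
End closed_subspace.
Arguments closedSubspace {R} V.

Section dual.
Context {R : realType} (V : normedModType R).

Definition ctsfunctional : {pred (V -> R)} :=
  mem [set f : V -> R | scalar f /\ continuous f].

Fact ctsfunctional_submod_closed : submod_closed ctsfunctional.
Proof.
split.
  rewrite inE; split; last by move=> x; exact: cst_continuous.
  by move=> a u v; rewrite /= mulr0 addr0.
move=> a f g; rewrite !inE => -[fl fc] [gl gc]; split.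
  move=> b u v; change (a * f (b *: u + v) + g (b *: u + v) =
    b * (a * f u + g u) + (a * f v + g v)).
  by rewrite fl gl !mulrDr !addrA mulrCA; congr (_ + _); rewrite addrAC.
move=> x.
by apply: (@continuousD R R^o); [apply: continuousZr|exact: gc] => //; exact: fc.
Qed.

HB.instance Definition _ :=
  GRing.isSubmodClosed.Build R (V -> R) ctsfunctional ctsfunctional_submod_closed.

Definition dual : Type := {f : V -> R | f \in ctsfunctional}.

HB.instance Definition _ := SubChoice.on dual.
HB.instance Definition _ := [SubChoice_isSubLmodule of dual by <:].

Definition dual_fun (f : dual) : V -> R := val f.
Coercion dual_fun : dual >-> Funclass.

Let B : set V := [set x | `|x| <= 1].

Lemma dual_ubound (f : dual) : has_ubound [set `|f x| | x in B].
Proof.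
have [fl fc] : scalar f /\ continuous f by have := valP f; rewrite inE.
pose l := GRing.isLinear.Build R V R^o *:%R f fl.
pose F : {linear V -> R^o} := HB.pack (f : V -> R^o) l.
have : continuous F by exact: fc.
move=> /(_ 0)/continuous_linear_bounded/linear_boundedP[M [_ fM]].
have M1 : M < `|M| + 1 by rewrite (le_lt_trans (ler_norm _))// ltrDl.
exists (`|M| + 1) => _ [x x1 <-].
by rewrite (le_trans (fM _ M1 x))// ler_piMr// addr_ge0.
Qed.

Let norm (f : dual) : R := sup_abs B f.

Let B0 : B !=set0. Proof. by exists 0; rewrite /B/= normr0. Qed.

Let normD (f g : dual) : norm (f + g) <= norm f + norm g.
Proof. by apply: sup_absD => //; exact: dual_ubound. Qed.

Let normZ (a : R) (f : dual) : norm (a *: f) = `|a| * norm f.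
Proof. by apply: sup_absZ => //; exact: dual_ubound. Qed.

Let norm0_eq0 (f : dual) : norm f = 0 -> f = 0.
Proof.
have [fl _] : scalar f /\ continuous f by have := valP f; rewrite inE.
have fZ (a : R) x : f (a *: x) = a * f x.
  have f0 : f 0 = 0.
    have := fl 1 0 0; rewrite scale1r addr0 mul1r => /eqP.
    by rewrite -subr_eq subrr eq_sym => /eqP.
  by rewrite -[a *: x]addr0 fl f0 addr0.
move=> f0; apply/val_inj/funext => x.
have [->|x0] := eqVneq x 0; first by have := fZ 0 0; rewrite scale0r mul0r.
have : `|f (`|x|^-1 *: x)| = 0.
  apply/eqP; rewrite eq_le normr_ge0 andbT -[leRHS]f0.
  apply: sup_abs_ge; first exact: dual_ubound.
  by rewrite /B/= normrZ normfV normr_id mulVf// normr_eq0.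
move/normr0_eq0/eqP; rewrite fZ mulf_eq0 invr_eq0 normr_eq0 (negbTE x0) /=.
by move/eqP.
Qed.

HB.instance Definition _ :=
  Lmodule_isNormed.Build R dual normD normZ norm0_eq0.

Lemma dual_normE (f : dual) :
  `|f| = sup [set `|f x| | x in [set x : V | `|x| <= 1]].
Proof. by []. Qed.

End dual.

Definition isomorphic {R : realType} (V W : normedModType R) : Prop :=
  exists (f : {linear V -> W}) (g : W -> V),
    [/\ cancel f g, cancel g f, continuous f & continuous g].

Section SB.
Variable R : realType.

Definition effros_borel_gen : set (set (closedSubspace (C2N R))) :=
  [set [set X : closedSubspace (C2N R) | X `&` U !=set0] |
    U in [set U : set (C2N R) | open U]].

Definition SB : Type := g_sigma_algebraType effros_borel_gen.

HB.instance Definition _ := Measurable.on SB.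

End SB.

(* Main.v *)
Require Import Defs.
From HB Require Import structures.
From mathcomp Require Import all_boot all_order all_algebra.
From mathcomp Require Import all_classical all_reals all_analysis.
From mathcomp Require Import ring lra zify.
Import Order.TTheory GRing.Theory Num.Theory.
Import numFieldNormedType.Exports.
Set Implicit Arguments.
Unset Strict Implicit.
Unset Printing Implicit Defensive.
Local Open Scope classical_set_scope.
Local Open Scope ring_scope.

(* Code a separable space [X] by a dense sequence [x]; a functional on [X] is
then a real sequence [phi], and the dual ball of radius [k] is compact for the
pointwise topology, in a closed way with respect to [x]. The only condition
that is not visibly analytic is that a sequence [ph] of functionals is
norm-dense in the dual. If X^* is separable, there is no Cantor scheme of cells
meeting the dual ball whose branches are separated by a fixed gap. Since [A] is
analytic, the finite attempts to build simultaneously a code of some [X] in [A]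
and such a scheme over [X] form a tree on a countable set, and this tree is
well-founded. A single well-founded tree, depending on [A] only, therefore
bounds the Szlenk-type derivatives of the dual balls of all [X] in [A], so that
density of [ph] is witnessed by a function which tells, for each node of the
tree, which basic cells are discarded at this node, and which [ph n] is the
centre of a small ball containing what remains of the cell. By compactness the
correctness of the witness is a countable conjunction of open conditions. *)

(** * Analytic subsets of the Baire space *)

(** Density of [ph] quantifies over all functionals, so analyticity has to come from a certificate
    that is itself a point of [baire]. This is possible because the relation between a node and its
    children mentions neither [X] nor a code of [X]: for each [k] it is one fixed relation on a
    countable set, and its nodes replace the ordinal stages of the derivative. The certificate is
    used in two different ways. Whatever [ph] is, a correct certificate forces density up to
    [2 * gap k], by descent along the tree; conversely, a dense [ph] over a member of [A] has a
    certificate, because a functional that survived the derivative would allow a separating tree to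
    be extended forever. The factor 2 adds the diameter of what is left of a cell to the distance
    from one of its points to the nearest [ph n]. Failure of the certificate at a cell asserts the
    existence of a functional in a compact ball; it is closed once every condition on that
    functional is closed, which is why cells occur both with strict inequalities and with
    margins. *)

Definition baire := nat -> nat.

Definition bcvg (u : nat -> baire) (z : baire) :=
  forall i, \forall n \near \oo, u n i = z i.

(** Sequential closedness is closedness here, the product of discrete topologies being
    metrizable. *)
Definition bclosed (P : set baire) :=
  forall u z, bcvg u z -> (forall n, P (u n)) -> P z.

Definition beven (v : baire) : baire := fun i => v i.*2.
Definition bodd (v : baire) : baire := fun i => v i.*2.+1.
Definition bjoin (z w : baire) : baire :=
  fun i => if odd i then w i./2 else z i./2.

Definition bsub (z : baire) (t : nat) : baire := fun i => z (pickle (t, i)).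

Definition banalytic (P : set baire) :=
  exists2 F, bclosed F & forall z, P z <-> exists w, F (bjoin z w).

Lemma bevenK z w : beven (bjoin z w) = z.
Proof. by apply/funext => i; rewrite /beven/bjoin odd_double doubleK. Qed.

Lemma boddK z w : bodd (bjoin z w) = w.
Proof. by apply/funext => i; rewrite /bodd/bjoin /= odd_double /= uphalf_double. Qed.

Lemma bjoinK v : bjoin (beven v) (bodd v) = v.
Proof.
apply/funext => i; rewrite /beven/bjoin/bodd.
by case: ifPn => i2; congr v; rewrite -[RHS]odd_double_half ?i2 // (negbTE i2).
Qed.

Lemma bsub_ex (f : nat -> baire) : exists z, forall t, bsub z t = f t.
Proof.
exists (fun v => if unpickle v is Some (t, i) then f t i else 0%N) => t.
by apply/funext => i; rewrite /bsub pickleK.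
Qed.

Lemma bcvg_reindex (h : nat -> nat) u z :
  bcvg u z -> bcvg (fun n => u n \o h) (z \o h).
Proof. by move=> uz i; exact: uz. Qed.

Lemma bcvg_even u z : bcvg u z -> bcvg (beven \o u) (beven z).
Proof. exact: (bcvg_reindex double). Qed.

Lemma bcvg_odd u z : bcvg u z -> bcvg (bodd \o u) (bodd z).
Proof. exact: (bcvg_reindex (fun i => i.*2.+1)). Qed.

Lemma bcvg_sub u z t : bcvg u z -> bcvg (fun n => bsub (u n) t) (bsub z t).
Proof. exact: (bcvg_reindex (fun i => pickle (t, i))). Qed.

Lemma bcvg_prefix u z k : bcvg u z ->
  \forall n \near \oo, forall i, (i < k)%N -> u n i = z i.
Proof.
move=> uz; elim: k => [|k IH]; first exact: nearW.
near=> n => i; rewrite ltnS leq_eqVlt => /predU1P[->|ik]; first by near: n; exact: uz.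
by move: i ik; near: n.
Unshelve. all: by end_near. Qed.

Lemma bcvg_agree (u : nat -> baire) z :
  (forall n i, (i < n)%N -> u n i = z i) -> bcvg u z.
Proof.
move=> uz i; near=> n; apply: uz; near: n; exact: nbhs_infty_gt.
Unshelve. all: by end_near. Qed.

Lemma bcvg_shift u z k : bcvg u z -> bcvg (fun n => u (n + k)%N) z.
Proof.
move=> uz i; have [N _ uN] := uz i; exists N => // n /= Nn.
by apply: uN; rewrite /= (leq_trans Nn) ?leq_addr.
Qed.

Lemma banalytic_intro (G : baire -> baire -> Prop) :
  (forall u v z w, bcvg u z -> bcvg v w -> (forall n, G (u n) (v n)) -> G z w) ->
  banalytic [set z | exists w, G z w].
Proof.
move=> Gc; exists [set v | G (beven v) (bodd v)].
  move=> u z uz Gu; apply: Gc Gu; [exact: bcvg_even|exact: bcvg_odd].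
by move=> z; split=> -[w Gw]; exists w; move: Gw; rewrite /= bevenK boddK.
Qed.

Lemma bclosed_analytic P : bclosed P -> banalytic P.
Proof.
move=> Pc; rewrite (_ : P = [set z | exists w : baire, P z]).
  by apply: banalytic_intro => u v z w uz _; exact: Pc.
by apply/seteqP; split=> z /=; [exists z|case].
Qed.

(* In the projection, [w 0] names a cylinder around [z] contained in [P]. *)
Lemma bopen_analytic P : bclosed (~` P) -> banalytic P.
Proof.
move=> Pc.
pose G (z w : baire) := forall z', (forall i, (i < w 0)%N -> z' i = z i) -> P z'.
rewrite (_ : P = [set z | exists w, G z w]); last first.
  apply/seteqP; split=> z /=; last by case=> w; apply.
  move=> Pz; apply: contrapT => /forallNP nG.
  have /choice[u uP] : forall n, exists z', (forall i, (i < n)%N -> z' i = z i) /\ ~ P z'.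
    move=> n; have /existsNP[z' /not_implyP[]] := nG (fun=> n).
    by exists z'.
  suff: (~` P) z by [].
  apply: (Pc u); last by move=> n; case: (uP n).
  by apply: bcvg_agree => n i; case: (uP n) => + _; exact.
apply: banalytic_intro => u v z w uz vw Gn z' zz'.
have [n [vn un]] : exists n, v n 0%N = w 0%N /\ forall i, (i < w 0)%N -> u n i = z i.
  have /filter_ex[n [? ?]] : \forall n \near \oo, v n 0%N = w 0%N /\
      forall i, (i < w 0)%N -> u n i = z i.
    by apply: filterI; [exact: vw|exact: bcvg_prefix].
  by exists n.
by apply: (Gn n) => i; rewrite vn => iw; rewrite un// zz'.
Qed.

Lemma banalyticP P : banalytic P -> exists G : baire -> baire -> Prop,
  (forall u v z w, bcvg u z -> bcvg v w -> (forall n, G (u n) (v n)) -> G z w) /\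
  P = [set z | exists w, G z w].
Proof.
move=> [F Fc FP]; exists (fun z w => F (bjoin z w)); split; last by apply/seteqP; split=> z /FP.
move=> u v z w uz vw; apply: Fc => i.
rewrite /bjoin; case: ifP => _; [exact: vw|exact: uz].
Qed.

(** The slices of one sequence hold the witnesses for all [i], so that an intersection of
    projections becomes the projection of an intersection. *)
Lemma banalytic_all (I : countType) (P : I -> set baire) :
  (forall i, banalytic (P i)) -> banalytic [set z | forall i, P i z].
Proof.
move=> Pa; have /choice[G GP] := fun i => banalyticP (Pa i).
rewrite (_ : [set _ | _] =
    [set z | exists w, forall i, G i z (bsub w (pickle i))]); last first.
  apply/seteqP; split=> z /=; last first.
    move=> [w Gw] i; have [_ ->] := GP i; by exists (bsub w (pickle i)).
  move=> Pz.
  have /choice[f fP] : forall i, exists w, G i z w.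
    by move=> i; have := Pz i; have [_ ->] := GP i.
  have [w wf] := bsub_ex (fun t => if unpickle t is Some i then f i else fun=> 0%N).
  by exists w => i; rewrite wf pickleK.
apply: banalytic_intro => u v z w uz vw Gn i.
have [Gc _] := GP i; apply: (Gc u (fun n => bsub (v n) (pickle i))) => //.
exact: bcvg_sub.
Qed.

(** The first entry of the witness names the index [i]. Along a convergent sequence of witnesses it
    is eventually constant, so the limit inherits a single index. *)
Lemma banalytic_ex (I : countType) (P : I -> set baire) :
  (forall i, banalytic (P i)) -> banalytic [set z | exists i, P i z].
Proof.
move=> Pa; have /choice[G GP] := fun i => banalyticP (Pa i).
pose H (z w : baire) := exists2 i, w 0%N = pickle i & G i z (fun n => w n.+1).
rewrite (_ : [set _ | _] = [set z | exists w, H z w]); last first.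
  apply/seteqP; split=> z /= [].
    move=> i; have [_ ->] := GP i => -[w Gw].
    by exists (fun n => if n is m.+1 then w m else pickle i); exists i.
  by move=> w [i _ Gw]; exists i; have [_ ->] := GP i; eexists; exact: Gw.
apply: banalytic_intro => u v z w uz vw Hn.
have [k _ vk] := vw 0%N.
have [i vi _] := Hn k; exists i; first by rewrite -vi -(vk k) /=.
have [Gc _] := GP i.
apply: (Gc (fun n => u (n + k)%N) (fun n j => v (n + k)%N j.+1)) => //.
- exact: bcvg_shift.
- exact: (bcvg_reindex succn (bcvg_shift k vw)).
move=> n; have [j vj] := Hn (n + k)%N.
suff -> : i = j by [].
apply: (pcan_inj pickleK); rewrite -vi -vj (vk k) ?(vk (n + k)%N) //=; exact: leq_addl.
Qed.

Lemma banalytic_and (P Q : set baire) :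
  banalytic P -> banalytic Q -> banalytic [set z | P z /\ Q z].
Proof.
move=> Pa Qa; have := @banalytic_all bool (fun b => if b then P else Q).
have -> : [set z | forall b : bool, (if b then P else Q) z] = [set z | P z /\ Q z].
  apply/seteqP; split=> z /=; first by move=> H; split; [exact: (H true)|exact: (H false)].
  by move=> [? ?] [].
by apply; case.
Qed.

Lemma banalytic_or (P Q : set baire) :
  banalytic P -> banalytic Q -> banalytic [set z | P z \/ Q z].
Proof.
move=> Pa Qa; have := @banalytic_ex bool (fun b => if b then P else Q).
have -> : [set z | exists b : bool, (if b then P else Q) z] = [set z | P z \/ Q z].
  apply/seteqP; split=> z /=; first by move=> [[]]; [left|right].
  by move=> [?|?]; [exists true|exists false].
by apply; case.
Qed.

Lemma banalytic_reindex (g : baire -> baire) (P : set baire) :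
  (forall u z, bcvg u z -> bcvg (g \o u) (g z)) ->
  banalytic P -> banalytic [set z | P (g z)].
Proof.
move=> gc /banalyticP[G [Gc ->]].
by apply: banalytic_intro => u v z w uz vw; apply: Gc vw; exact: gc.
Qed.

Lemma banalytic_proj (P : set baire) :
  banalytic P -> banalytic [set z | exists v, P (bjoin z v)].
Proof.
move=> [F Fc FP].
rewrite (_ : [set _ | _] =
    [set z | exists w, F (bjoin (bjoin z (beven w)) (bodd w))]); last first.
  apply/seteqP; split=> z /=.
    by move=> [v /FP[w Fw]]; exists (bjoin v w); rewrite bevenK boddK.
  by move=> [w Fw]; exists (beven w); apply/FP; exists (bodd w).
apply: banalytic_intro => u v z w uz vw; apply: Fc => i; rewrite /bjoin.
case: ifP => _; first exact: vw.
by case: ifP => _; [exact: vw|exact: uz].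
Qed.

(** * Complete separable spaces as images of the Baire space *)

Section fast_cauchy.
Variable R : realType.

Definition eps (k : nat) : R := 2^-1 ^+ k.

Lemma eps_gt0 k : 0 < eps k.
Proof. by rewrite /eps exprn_gt0. Qed.

Lemma epsS k : eps k = eps k.+1 + eps k.+1.
Proof. by rewrite /eps exprS; field. Qed.

Lemma cvg_eps : eps k @[k --> \oo] --> 0.
Proof. by apply: cvg_expr; rewrite ger0_norm ?invf_lt1 ?ltr1n. Qed.

Lemma eps_lt (d : R) : 0 < d -> exists k, eps k < d.
Proof.
move=> d0; have /cvgrPdist_lt/(_ _ d0)[k _ kd] := cvg_eps.
exists k; have := kd k (leqnn _).
by rewrite /= sub0r normrN ger0_norm// ltW// eps_gt0.
Qed.

Lemma eps_le j k : (j <= k)%N -> eps k <= eps j.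
Proof. by move=> jk; rewrite /eps ler_wiXn2l// ?invf_le1 ?ler1n. Qed.

(** In this form completeness of function spaces reduces to pointwise limits. The steps from [k] on
    sum to [2 * eps k]; the factor 4 leaves room for the strict inequality in the limit. *)
Definition fast_complete (M : pseudoMetricType R) := forall u : nat -> M,
  (forall k, ball (u k) (eps k) (u k.+1)) ->
  exists l, forall k, ball (u k) (4 * eps k) l.

Lemma fast_cauchy_ball (M : pseudoMetricType R) (u : nat -> M) :
  (forall k, ball (u k) (eps k) (u k.+1)) ->
  forall j k, ball (u k) (2 * eps k) (u (k + j)%N).
Proof.
move=> uS; elim=> [|j IH] k.
  by rewrite addn0; apply: ballxx; rewrite mulr_gt0// eps_gt0.
have := ball_triangle (uS k) (IH k.+1); rewrite addSnnS; apply: le_ball.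
by rewrite [eps k]epsS; lra.
Qed.

Lemma complete_fast (M : pseudoMetricType R) :
  complete_space M -> fast_complete M.
Proof.
move=> Mc u uS.
have [|l ul] := Mc (u @ \oo) _.
  apply: cauchy_exP => d d0.
  have [k kd] := @eps_lt (d / 2) ltac:(by rewrite divr_gt0).
  exists (u k); exists k => // n /= kn.
  rewrite -(subnKC kn); apply: le_ball (fast_cauchy_ball uS _ _); lra.
exists l => k.
have : \forall n \near \oo, (k <= n)%N /\ ball l (eps k) (u n).
  apply: filterI; first exact: nbhs_infty_ge.
  by move/cvg_ballP : ul; apply; exact: eps_gt0.
move=> /filter_ex[n [kn /ball_sym ln]].
have := ball_triangle (fast_cauchy_ball uS (n - k) k); rewrite subnKC// => /(_ _ _ ln).
by apply: le_ball; have := eps_gt0 k; lra.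
Qed.

Lemma separable_seq (M : pseudoMetricType R) (p0 : M) : separable M ->
  exists e : nat -> M, forall p d, 0 < d -> exists n, ball p d (e n).
Proof.
move=> [D /countable_injP[f fD] Dd].
exists (fun n => xget p0 [set q | D q /\ f q = n]) => p d d0.
have [q [pq Dq]] : (ball p d)° `&` D !=set0.
  by apply: Dd; [exists p; exact: nbhsx_ballx|exact: open_interior].
exists (f q); case: xgetP => [q' _ [Dq' qq']|/(_ q)]; last by case.
by rewrite (fD q' q) ?inE//; exact: interior_subset.
Qed.

Section representation.
Variables (M : pseudoMetricType R) (e : nat -> M).
Hypothesis Mc : fast_complete M.

Fixpoint rapprox (z : baire) (k : nat) : M :=
  if k is j.+1 then
    if `[< ball (rapprox z j) (eps j) (e (z k)) >] then e (z k) else rapprox z j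
  else e (z 0%N).

Lemma rapproxS z k : ball (rapprox z k) (eps k) (rapprox z k.+1).
Proof.
by rewrite /=; case: asboolP => // _; apply: ballxx; exact: eps_gt0.
Qed.

(* A total continuous surjection of the Baire space onto [M]: entries of the
name that break the fast Cauchy condition are ignored. *)
Definition brep (z : baire) : M := sval (cid (Mc (rapproxS z))).

Lemma brep_ball z k : ball (rapprox z k) (4 * eps k) (brep z).
Proof. by rewrite /brep; case: cid. Qed.

Lemma rapprox_eq u z k : (forall i, (i < k.+1)%N -> u i = z i) ->
  rapprox u k = rapprox z k.
Proof.
elim: k => [|k IH] uz /=; first by rewrite uz.
by rewrite IH ?uz// => i ik; apply: uz; rewrite ltnW.
Qed.

Lemma brep_cvg u z : bcvg u z -> brep (u n) @[n --> \oo] --> brep z.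
Proof.
move=> uz; apply/cvg_ballP => d d0.
have [k kd] := @eps_lt (d / 8) ltac:(by rewrite divr_gt0).
have := bcvg_prefix k.+1 uz; apply: filterS => n un.
have /ball_sym := brep_ball z k; rewrite -(rapprox_eq un) => zk.
have := ball_triangle zk (brep_ball (u n) k).
by apply: le_ball; lra.
Qed.

Lemma brep_surj : hausdorff_space M ->
  (forall p d, 0 < d -> exists n, ball p d (e n)) ->
  forall p, exists z, brep z = p.
Proof.
move=> Mh ed p.
(* At a quarter of [eps k], consecutive guesses are within [eps k] of each other, so no entry of the
   name is ignored. *)
have /choice[z zp] : forall k, exists n, ball p (eps k / 4) (e n).
  by move=> k; apply: ed; rewrite divr_gt0// eps_gt0.
have rz k : rapprox z k = e (z k).
  elim: k => //= k ->; case: asboolP => // -[].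
  apply: le_ball (ball_triangle (ball_sym (zp k)) (zp k.+1)).
  by rewrite [eps k]epsS; have := eps_gt0 k.+1; lra.
exists z; apply/eqP; apply: contrapT => /negP.
move: Mh; rewrite ball_hausdorff => Mh /Mh[[r s] /= /eqP].
apply/eqP/set0P.
have [k ks] := @eps_lt (s%:num) ltac:(by []).
have [j jr] := @eps_lt (r%:num / 4) ltac:(by rewrite divr_gt0).
exists (e (z (maxn j k))); split.
  have /ball_sym := brep_ball z (maxn j k); rewrite rz; apply: le_ball.
  by have := eps_le (leq_maxl j k); lra.
apply: le_ball (zp (maxn j k)).
by have := eps_le (leq_maxr j k); have := eps_gt0 (maxn j k); lra.
Qed.

End representation.
End fast_cauchy.

(** * Limits and the space of continuous functions on the Cantor space *)

Lemma cantor_cylinder (t : cantor_space) n :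
  nbhs t [set s : cantor_space | forall j, (j < n)%N -> s j = t j].
Proof.
elim: n => [|n IH].
  by rewrite (_ : [set _ | _] = setT); [exact: filterT|apply/seteqP; split].
have sn := @proj_continuous _ (fun=> bool) n t [set t n] (discrete_set1 _).
apply: filterS2 IH sn => s st sn j; rewrite ltnS leq_eqVlt => /predU1P[->|]//.
exact: st.
Qed.

Section limits.
Variable R : realType.

Lemma norm_bound_cvg (V : normedModType R) (u : nat -> V) l (C : R) :
  (forall k, `|u k - l| <= C * eps R k) -> u k @[k --> \oo] --> l.
Proof.
move=> ul; apply/cvgrPdist_le => d d0.
have C1 : 0 < `|C| + 1 by rewrite ltr_wpDl.
have [k kd] := @eps_lt R (d / (`|C| + 1)) ltac:(by rewrite divr_gt0).
exists k => // n /= kn; rewrite distrC (le_trans (ul n))//.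
rewrite (@le_trans _ _ ((`|C| + 1) * eps R n)) ?ler_wpM2r ?(ltW (eps_gt0 R n))//.
  by rewrite (le_trans (ler_norm _))// lerDl.
rewrite mulrC -ler_pdivlMr// (le_trans _ (ltW kd))// eps_le//.
Qed.

Lemma real_fast_complete : fast_complete (R : pseudoMetricType R).
Proof. by apply: complete_fast => F PF Fc; exists (lim F); exact: cauchy_cvg. Qed.

Lemma fast_pointwise_limit (T : Type) (u : nat -> T -> R) (D : set T) :
  (forall k t, D t -> `|u k t - u k.+1 t| < eps R k) ->
  exists g, forall k t, D t -> `|u k t - g t| < 3 * eps R k.
Proof.
move=> uS.
have /choice[g gP] : forall t, exists l, D t -> forall k, `|u k t - l| < 4 * eps R k.
  move=> t; have [Dt|nDt] := pselect (D t); last by exists 0.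
  have [|l lP] := @real_fast_complete (fun k => u k t); first by move=> k; exact: uS.
  by exists l => _ k; exact: lP.
exists g => k t Dt.
rewrite (le_lt_trans (ler_distD (u k.+1 t) _ _))//.
by have := uS k t Dt; have := gP t Dt k.+1; rewrite [eps R k]epsS; lra.
Qed.

(** Tychonoff's theorem through an ultrafilter finer than [\oo]: all coordinates converge along the
    same filter, as after a diagonal extraction. *)
Lemma bounded_ultra_cvg (phi : nat -> nat -> R) (b : nat -> R) :
  (forall m, \forall n \near \oo, `|phi n m| <= b m) ->
  exists F : set_system nat, [/\ ProperFilter F, \oo `<=` F &
    exists l, forall m, phi n m @[n --> F] --> (l m : R)].
Proof.
move=> phib; have [F [FU oF]] := ultraFilterLemma eventually_filter.
exists F; split=> //; first exact: ultra_proper.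
suff H m : exists l : R, phi n m @[n --> F] --> l.
  by have [l lF] := choice H; exists l.
have Fb : (phi ^~ m @ F) [set` `[- b m, b m]].
  apply: oF; apply: filterS (phib m) => n.
  by rewrite /= in_itv /= ler_norml.
have [l [_ lF]] := @segment_compact R (- b m) (b m) _ _ Fb.
exists l => N /lF Nl /=.
have [//|FN] := @in_ultra_setVsetC _ _ [set n | N (phi n m)] FU.
by have [x [nNx Nx]] := Nl (~` N) FN.
Qed.

End limits.

Section C2N_facts.
Variable R : realType.
Implicit Types f g : C2N R.

Lemma C2N_cts f : continuous f.
Proof. by have := valP f; rewrite inE. Qed.

Lemma C2N_norm_ge f t : `|f t| <= `|f|.
Proof. by rewrite C2N_normE; apply: sup_abs_ge => //; exact: C2N_ubound. Qed.

Lemma C2N_norm_le f M : (forall t, `|f t| <= M) -> `|f| <= M.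
Proof.
by move=> fM; rewrite C2N_normE; apply: sup_abs_le => [|t _//]; exists point.
Qed.

Lemma C2N_fast_complete : fast_complete (C2N R).
Proof.
suff : forall u : nat -> C2N R, (forall k, ball (u k) (eps R k) (u k.+1)) ->
  exists l, forall k, ball (u k) (4 * eps R k) l by [].
move=> u uS.
have [|g gP] := @fast_pointwise_limit R cantor_space (fun k => C2N_fun (u k)) setT.
  move=> k t _; apply: le_lt_trans (C2N_norm_ge (u k - u k.+1) t) _.
  by have := uS k; rewrite -ball_normE.
have gc : continuous g.
  move=> t; apply/cvgrPdist_lt => d d0.
  have [k kd] := @eps_lt R (d / 9) ltac:(by rewrite divr_gt0).
  have /cvgrPdist_lt/(_ (d / 3)) := @C2N_cts (u k) t.
  rewrite divr_gt0// => /(_ isT); apply: filterS => s us.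
  have := gP k t I; rewrite distrC => gt; have gs := gP k s I.
  rewrite (le_lt_trans (ler_distD (u k t) _ _))//.
  have := ler_distD (u k s) (u k t) (g s); lra.
have gC : g \in @ctsfun R by rewrite inE.
exists (exist _ g gC) => k; rewrite -ball_normE /=.
apply: (@le_lt_trans _ _ (3 * eps R k)); last by have := eps_gt0 R k; lra.
by apply: C2N_norm_le => t; exact/ltW/gP.
Qed.

(** Otherwise pairs agreeing on longer and longer prefixes would converge, along an ultrafilter, to
    one common point, where [f] is continuous. *)
Lemma cantor_uniform f (d : R) : 0 < d ->
  exists n, forall s t : cantor_space, (forall i, (i < n)%N -> s i = t i) ->
    `|f s - f t| < d.
Proof.
move=> d0; apply: contrapT => /forallNP nd.
have /choice[u uP] : forall n, exists st : cantor_space * cantor_space,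
    (forall i, (i < n)%N -> st.1 i = st.2 i) /\ d <= `|f st.1 - f st.2|.
  move=> n; have /existsNP[s /existsNP[t /not_implyP[st /negP]]] := nd n.
  by rewrite -leNgt; exists (s, t).
have [F [FU oF]] := ultraFilterLemma eventually_filter.
have [x [_ xF]] := @cantor_space_compact ((fun n => (u n).1) @ F) _ filterT.
have x2 (N : set cantor_space) : nbhs x N -> F [set n | N (u n).1].
  move=> /xF Nl; have [//|FN] := @in_ultra_setVsetC _ _ [set n | N (u n).1] FU.
  by have [y [nNy Ny]] := Nl (~` N) FN.
have c1 : (u n).1 @[n --> F] --> x by exact: x2.
have c2 : (u n).2 @[n --> F] --> x.
  apply/cvg_sup => i U [V] [[W] oW <-] WxN WU.
  have : F [set n | (u n).1 i = x i].
    apply: (x2 [set y | y i = x i]).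
    have := @proj_continuous _ (fun=> bool) i x [set x i]; apply.
    exact: discrete_set1.
  have : F [set n | (i < n)%N] by apply: oF; exact: nbhs_infty_gt.
  move=> Fi F1; suff : F [set n | U (u n).2] by [].
  apply: filterS2 Fi F1 => n /= ik xi; apply: WU.
  by move: WxN; rewrite /= -xi (uP n).1.
have : f (u n).1 - f (u n).2 @[n --> F] --> f x - f x.
  by apply: cvgB; apply: continuous_cvg => //; exact: C2N_cts.
rewrite subrr => /cvgrPdist_lt/(_ _ d0)/filter_ex[n].
by rewrite sub0r normrN ltNge (uP n).2.
Qed.

(** Rational-valued functions of finitely many coordinates form a countable set, dense by uniform
    continuity. *)
Lemma C2N_dense_seq : exists e : nat -> C2N R, forall f d, 0 < d ->
  exists n, ball f d (e n).
Proof.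
pose I : countType := {n : nat & {ffun n.-tuple bool -> rat}}.
pose h (i : I) (t : cantor_space) : R :=
  ratr (projT2 i [tuple t (val j) | j < projT1 i]).
have hc i : h i \in @ctsfun R.
  rewrite inE => t; apply: cvg_near_cst.
  have := cantor_cylinder t (projT1 i).
  apply: filterS => s st; rewrite /h; congr (ratr (_ _)).
  by apply: eq_from_tnth => j; rewrite !tnth_mktuple; exact: st (ltn_ord j).
exists (fun k => if unpickle k is Some i then exist _ (h i) (hc i) else 0 : C2N R) => f d d0.
have [n fn] := cantor_uniform f (divr_gt0 d0 (@ltr0n R 4)).
pose pt (w : n.-tuple bool) : cantor_space := fun j => nth false w j.
have /choice[r rP] : forall w, exists q : rat, `|f (pt w) - ratr q| < d / 4.
  move=> w; have [q] := @rat_in_itvoo R (f (pt w) - d / 4) (f (pt w) + d / 4) ltac:(lra).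
  by rewrite in_itv /= => /andP[q1 q2]; exists q; rewrite ltr_norml; apply/andP; split; lra.
exists (pickle (existT _ n [ffun w => r w] : I)); rewrite pickleK -ball_normE /=.
apply: (@le_lt_trans _ _ (d / 2)); last by lra.
apply: C2N_norm_le => t.
rewrite [X in `|X|]/(f t - h _ t) /h /= ffunE.
set w := mktuple _.
have /ltW ft : `|f t - f (pt w)| < d / 4.
  apply: fn => i ni; rewrite /pt -[i]/(val (Ordinal ni)) -tnth_nth tnth_mktuple//.
have := ler_distD (f (pt w)) (f t) (ratr (r w)); have := rP w; lra.
Qed.

End C2N_facts.

(** * Extension by density and dual spaces *)

Section normed_maps.
Variables (R : realType) (U V : normedModType R).

Lemma linear_subr (h : U -> V) : linear h -> forall u w, h u - h w = h (u - w).
Proof.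
move=> hl u w; have -> : u - w = -1 *: w + u by rewrite scaleN1r addrC.
by rewrite hl scaleN1r addrC.
Qed.

Lemma lipschitz_cts (h : U -> V) (M : R) :
  (forall u w, `|h u - h w| <= M * `|u - w|) -> continuous h.
Proof.
move=> hM u; apply/cvgrPdist_lt => d d0.
have M1 : 0 < `|M| + 1 by rewrite ltr_wpDl.
have /cvgrPdist_lt/(_ (d / (`|M| + 1))) : w @[w --> u] --> u by exact: cvg_id.
rewrite divr_gt0// => /(_ isT); apply: filterS => w.
rewrite ltr_pdivlMr// => uw; rewrite (le_lt_trans (hM _ _))//.
apply: le_lt_trans uw; rewrite mulrC ler_wpM2l// (le_trans (ler_norm _))//.
by rewrite lerDl.
Qed.

(** Passing from distances to [p] to steps of [a] costs a factor 2, and passing to steps of [b] a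
    factor [M]; with [M + 1] in the rate the steps of [b] stay strictly below [eps R k], also for
    [M = 0]. *)
Lemma fast_lipschitz_cvg (a : nat -> U) (b : nat -> V) p (M : R) :
  fast_complete V -> 0 <= M ->
  (forall k, `|p - a k| < eps R k / (2 * (M + 1))) ->
  (forall k, `|b k - b k.+1| <= M * `|a k - a k.+1|) ->
  a k @[k --> \oo] --> p /\ exists q : V, b k @[k --> \oo] --> q.
Proof.
move=> Vc M0 aP bS; have M1 : 0 < 2 * (M + 1) by rewrite mulr_gt0// ltr_wpDl.
split.
  apply: (norm_bound_cvg (C := 1)) => k; rewrite mul1r distrC.
  apply: le_trans (ltW (aP k)) _; rewrite ler_pdivrMr// ler_peMr ?(ltW (eps_gt0 R k))//.
  by rewrite -[leLHS]mulr1 ler_pM ?ler1n ?ler0n ?ler01// lerDr.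
have [|q qP] := Vc b.
  move=> k; rewrite -ball_normE /=; apply: le_lt_trans (bS k) _.
  have : `|a k - a k.+1| <= eps R k / (M + 1).
    apply: le_trans (ler_distD p _ _) _; rewrite distrC.
    have -> : eps R k / (M + 1) = eps R k / (2 * (M + 1)) + eps R k / (2 * (M + 1)).
      by field; rewrite gt_eqF// ltr_wpDl.
    apply: lerD; first exact: ltW.
    apply: le_trans (ltW (aP k.+1)) _.
    by rewrite ler_wpM2r ?invr_ge0 ?(ltW M1)// eps_le.
  move=> /(ler_wpM2l M0) /le_lt_trans; apply.
  rewrite mulrCA gtr_pMr ?eps_gt0// ltr_pdivrMr ?ltr_wpDl// mul1r.
  by rewrite ltrDl.
exists q; apply: (norm_bound_cvg (C := 4)) => k; apply/ltW.
by have := qP k; rewrite -ball_normE.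
Qed.

End normed_maps.

Section dense_sequences.
Variable R : realType.

Definition dense_seq (V : normedModType R) (x : nat -> V) :=
  forall u d, 0 < d -> exists n, `|u - x n| < d.

Lemma dense_seq_cvg (V : normedModType R) (x : nat -> V) (u : V) :
  dense_seq x -> exists s : nat -> nat, x (s k) @[k --> \oo] --> u.
Proof.
move=> xd; have /choice[s sP] := fun k => xd u _ (eps_gt0 R k).
by exists s; apply: (norm_bound_cvg (C := 1)) => k; rewrite mul1r distrC ltW.
Qed.

Section extension.
Variables (U V : normedModType R) (x : nat -> U) (v : nat -> V) (M : R).
Hypothesis Vc : fast_complete V.
Hypothesis xd : dense_seq x.
Hypothesis M0 : 0 <= M.
Hypothesis xv : forall i j l (c : rat),
  `|v i + ratr c *: v j - v l| <= M * `|x i + ratr c *: x j - x l|.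

Let xv0 i l : `|v i - v l| <= M * `|x i - x l|.
Proof. by have := xv i i l 0; rewrite rmorph0 !scale0r !addr0. Qed.

Let T (u : U) (y : V) := exists s : nat -> nat,
  x (s k) @[k --> \oo] --> u /\ v (s k) @[k --> \oo] --> y.

Let T_ex u : exists y, T u y.
Proof.
have M1 : 0 < 2 * (M + 1) by rewrite mulr_gt0// ltr_wpDl.
have /choice[s sP] := fun k => xd u (divr_gt0 (eps_gt0 R k) M1).
have [xu [y vy]] := fast_lipschitz_cvg Vc M0 sP (fun k => xv0 (s k) (s k.+1)).
by exists y, s.
Qed.

Let T_bound u w p y y' z (a : R) : T u y -> T w y' -> T p z ->
  `|y + a *: y' - z| <= M * `|u + a *: w - p|.
Proof.
move=> [s [su sy]] [s' [sw sy']] [s'' [sp sz]].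
have /choice[c cP] : forall k, exists q : rat, `|ratr q - a| <= eps R k.
  move=> k; have [q] := @rat_in_itvoo R (a - eps R k) (a + eps R k)
    ltac:(have := eps_gt0 R k; lra).
  by rewrite in_itv /= => /andP[q1 q2]; exists q; rewrite ler_norml; apply/andP; split; lra.
have ca : (ratr (c k) : R) @[k --> \oo] --> a.
  by apply: (@norm_bound_cvg R R^o _ _ 1) => k; rewrite mul1r; exact: cP.
apply: (@ler_cvg_to _ \oo _ R
  (fun k => `|v (s k) + ratr (c k) *: v (s' k) - v (s'' k)|)
  (fun k => M * `|x (s k) + ratr (c k) *: x (s' k) - x (s'' k)|)).
- by apply: cvg_norm; apply: cvgB => //; apply: cvgD => //; exact: cvgZ.
- apply: cvgMl_tmp; apply: cvg_norm; apply: cvgB => //; apply: cvgD => //; exact: cvgZ.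
- by apply: nearW => k; exact: xv.
Qed.

(** The range of [x] need not be stable under linear operations, so the hypothesis compares
    combinations [x i + c x j] with a third entry [x l]. In the limit it gives everything at once:
    uniqueness of the value at [u] for [a = 0] and [p = u], linearity for [p = u + a w], and the
    bound for [a = 0] and [p = 0]. *)
Lemma dense_extension : exists f : U -> V,
  [/\ linear f, forall n, f (x n) = v n & forall u, `|f u| <= M * `|u|].
Proof.
have [f fT] := choice T_ex.
have f_eq u y : T u y -> f u = y.
  move=> uy; apply/eqP; rewrite -subr_eq0 -normr_le0.
  have := T_bound 0 (fT u) (fT u) uy.
  by rewrite !scale0r !addr0 subrr normr0 mulr0.
have f_lin : linear f.
  move=> a u w; apply/esym/eqP; rewrite -subr_eq0 -normr_le0.
  have := T_bound a (fT w) (fT u) (fT (a *: u + w)).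
  by rewrite [f w + _]addrC [w + _]addrC subrr normr0 mulr0.
exists f; split=> //.
  by move=> n; apply: f_eq; exists (fun=> n); split; exact: cvg_cst.
move=> u; have f0 : f 0 = 0.
  by have := f_lin (-1) 0 0; rewrite scaler0 addr0 scaleN1r addNr.
by have := T_bound 0 (fT u) (fT u) (fT 0); rewrite !scale0r !addr0 f0 !subr0.
Qed.

End extension.
End dense_sequences.

Section dual_facts.
Variables (R : realType) (V : normedModType R).
Implicit Types f g : dual V.

Lemma dual_scalar f : scalar f.
Proof. by have := valP f; rewrite inE => -[]. Qed.

Lemma dual_cts f : continuous f.
Proof. by have := valP f; rewrite inE => -[]. Qed.

Lemma dual0 f : f 0 = 0.
Proof.
have := dual_scalar f (-1) 0 0; rewrite scaler0 addr0 => ->.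
by rewrite mulN1r addNr.
Qed.

Lemma dualZ f a u : f (a *: u) = a * f u.
Proof. by have := dual_scalar f a u 0; rewrite dual0 !addr0. Qed.

Lemma dual_comb f u v w a : f (u + a *: v - w) = f u + a * f v - f w.
Proof.
have -> : u + a *: v - w = -1 *: w + (a *: v + u).
  by rewrite scaleN1r addrC (addrC u).
by rewrite !dual_scalar mulN1r addrC (addrC (a * _)).
Qed.

Lemma dual_norm_ge f u : `|f u| <= `|f| * `|u|.
Proof.
have [->|u0] := eqVneq u 0; first by rewrite dual0 !normr0 mulr0.
have u1 : 0 < `|u| by rewrite normr_gt0.
have : `|f (`|u|^-1 *: u)| <= `|f|.
  rewrite dual_normE; apply: sup_abs_ge; first exact: dual_ubound.
  by rewrite /= normrZ normfV normr_id mulVf// gt_eqF.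
by rewrite dualZ normrM normfV normr_id mulrC ler_pdivrMr.
Qed.

Lemma dual_norm_le f M : (forall u, `|u| <= 1 -> `|f u| <= M) -> `|f| <= M.
Proof.
move=> fM; rewrite dual_normE; apply: sup_abs_le => [|u /fM//].
by exists 0; rewrite /= normr0.
Qed.

Lemma dual_ex (h : V -> R) M : scalar h -> (forall u, `|h u| <= M * `|u|) ->
  exists f : dual V, (f : V -> R) = h.
Proof.
move=> hl hM.
have hc : continuous h.
  apply: (@lipschitz_cts R V R^o h M) => u w.
  by rewrite (linear_subr (V := R^o) hl) hM.
have hD : h \in @ctsfunctional R V by rewrite inE.
by exists (exist _ h hD).
Qed.

Lemma dual_fast_complete : fast_complete (dual V).
Proof.
suff : forall u : nat -> dual V, (forall k, ball (u k) (eps R k) (u k.+1)) ->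
  exists l, forall k, ball (u k) (4 * eps R k) l by [].
move=> u uS.
have [|g gP] := @fast_pointwise_limit R V (fun k => dual_fun (u k)) [set x | `|x| <= 1].
  move=> k t /= t1.
  apply: le_lt_trans (dual_norm_ge (u k - u k.+1) t) _.
  apply: (@le_lt_trans _ _ `|u k - u k.+1|); first by rewrite ler_piMr.
  by have := uS k; rewrite -ball_normE.
(* The limit [g] is controlled on the unit ball only; [h] is its homogeneous extension. *)
pose h t : R := `|t| * g (`|t|^-1 *: t).
have uh t : u k t @[k --> \oo] --> h t.
  apply: (@norm_bound_cvg R R^o _ _ (`|t| * 3)) => k.
  have [->|t0] := eqVneq t 0.
    by rewrite /h normr0 !mul0r subr0 dual0 normr0.
  have t1 : 0 < `|t| by rewrite normr_gt0.
  rewrite /h -[t in u k t](scalerKV (lt0r_neq0 t1)) dualZ -mulrBr normrM normr_id.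
  rewrite -mulrA ler_wpM2l//; apply/ltW/gP.
  by rewrite /= normrZ normfV normr_id mulVf// gt_eqF.
have hl : scalar h.
  move=> a s t.
  have ul : u k (a *: s + t) @[k --> \oo] --> a * h s + h t.
    under eq_fun => k do rewrite (dual_scalar (u k)).
    by apply: cvgD; [apply: cvgMl_tmp|]; exact: uh.
  by rewrite -(cvg_lim (@Rhausdorff R) (uh _)) (cvg_lim (@Rhausdorff R) ul).
have hB k t : `|t| <= 1 -> `|u k t - h t| <= 3 * eps R k.
  move=> t1; have [->|t0] := eqVneq t 0.
    rewrite /h normr0 !mul0r subr0 dual0 normr0 mulr_ge0//.
    exact/ltW/eps_gt0.
  have t2 : 0 < `|t| by rewrite normr_gt0.
  have : `|u k (`|t|^-1 *: t) - g (`|t|^-1 *: t)| < 3 * eps R k.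
    by apply: gP; rewrite /= normrZ normfV normr_id mulVf// gt_eqF.
  move=> /ltW; apply: le_trans.
  rewrite /h -[t in u k t](scalerKV (lt0r_neq0 t2)) dualZ -mulrBr normrM normr_id.
  by rewrite ler_piMl.
have [|l lh] := @dual_ex h (3 * eps R 0 + `|u 0%N|) hl.
  move=> t; have [->|t0] := eqVneq t 0.
    by rewrite /h normr0 mul0r normr0 mulr0.
  have t2 : 0 < `|t| by rewrite normr_gt0.
  have hZ : h t = `|t| * h (`|t|^-1 *: t).
    have h0 : h 0 = 0 by rewrite /h normr0 mul0r.
    by have := hl `|t| (`|t|^-1 *: t) 0; rewrite h0 !addr0 scalerKV ?gt_eqF.
  have t1 : `|(`|t|^-1 *: t)| <= 1 by rewrite normrZ normfV normr_id mulVf// gt_eqF.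
  rewrite hZ normrM normr_id mulrC ler_pM2r//.
  have := hB 0%N _ t1; have := dual_norm_ge (u 0%N) (`|t|^-1 *: t).
  have := ler_distD (u 0%N (`|t|^-1 *: t)) (h (`|t|^-1 *: t)) 0.
  rewrite !subr0 distrC.
  have : `|u 0%N| * `|(`|t|^-1 *: t)| <= `|u 0%N| by rewrite ler_piMr.
  lra.
exists l => k; rewrite -ball_normE /=.
apply: (@le_lt_trans _ _ (3 * eps R k)); last by have := eps_gt0 R k; lra.
apply: dual_norm_le => t t1.
by rewrite [X in `|X|](_ : _ = u k t - l t)// lh hB.
Qed.

Section dense.
Variables (x : nat -> V) (xd : dense_seq x).

Lemma dual_norm_le_dense f e :
  (forall m, `|x m| <= 1 -> `|f (x m)| <= e) -> `|f| <= e.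
Proof.
move=> fe; apply: dual_norm_le => u u1.
(* Shrinking [u] by [1 - eps R k] keeps the approximating entry of [x] inside the unit ball. *)
have /choice[s sP] : forall k, exists n, `|(1 - eps R k) *: u - x n| < eps R k.
  by move=> k; apply: xd; exact: eps_gt0.
have e1 k : eps R k <= 1 by rewrite -[leRHS](expr0 (2^-1)) (eps_le R (leq0n k)).
have su : x (s k) @[k --> \oo] --> u.
  apply: (norm_bound_cvg (C := 2)) => k; rewrite distrC.
  apply: le_trans (ler_distD ((1 - eps R k) *: u) _ _) _.
  rewrite -[X in `|X - _|]scale1r -scalerBl subKr normrZ.
  rewrite ger0_norm ?(ltW (eps_gt0 R k))//.
  have : eps R k * `|u| <= eps R k by rewrite ler_piMr// (ltW (eps_gt0 R k)).
  by have := sP k; lra.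
apply: (@cvgr_to_le _ \oo _ _ (fun k => `|f (x (s k))|)).
  by apply: cvg_norm; apply: continuous_cvg => //; exact: dual_cts.
apply: nearW => k; apply: fe.
have := ler_distD ((1 - eps R k) *: u) (x (s k)) 0; rewrite !subr0 normrZ distrC.
rewrite ger0_norm ?subr_ge0//.
have : (1 - eps R k) * `|u| <= (1 - eps R k) by rewrite ler_piMr// subr_ge0.
by have := sP k; lra.
Qed.

Lemma dual_norm_attain f : exists m, `|x m| <= 1 /\ `|f| <= 2 * `|f (x m)|.
Proof.
apply: contrapT => /forallNP nm.
have fm m : `|x m| <= 1 -> `|f (x m)| <= `|f| / 2.
  by move=> m1; have := nm m; case: (leP `|f| (2 * `|f (x m)|)) => [? []//|]; lra.
have := dual_norm_le_dense fm => f0.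
have {}f0 : `|f| <= 0 by lra.
have [m] := xd 0 (ltr01 : 0 < 1 :> R); rewrite sub0r normrN => /ltW m1.
by apply: (nm m); split=> //; rewrite (le_trans f0)// mulr_ge0.
Qed.

End dense.
End dual_facts.

(** * Analytic sets of closed subspaces *)

Section baire_subspace.
Variables (R : realType) (F : set baire).

(* [K] is a phantom parameter: the metric takes its values in [K]. *)
Definition bsubspace (K : realType) (G : set baire) : Type := {v : baire | G v}.
Local Notation Q := (bsubspace R F).

HB.instance Definition _ := gen_eqMixin (bsubspace R F).
HB.instance Definition _ := gen_choiceMixin (bsubspace R F).

(** This is [2^-n] for the first place [n] of difference, and 0 for equal sequences since the
    supremum of the empty set is 0. *)
Definition bdist (x y : Q) : R :=
  sup [set eps R i | i in [set i | sval x i != sval y i]].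

Lemma bdist_ge x y i : sval x i != sval y i -> eps R i <= bdist x y.
Proof.
move=> xyi; apply: ub_le_sup; last by exists i.
by exists (eps R 0) => _ [j _ <-]; exact: eps_le.
Qed.

Lemma bdist_le x y r : 0 <= r ->
  (forall i, sval x i != sval y i -> eps R i <= r) -> bdist x y <= r.
Proof.
move=> r0 xyr; rewrite /bdist.
have [->|/set0P xy] := eqVneq [set eps R i | i in [set i | sval x i != sval y i]] set0.
  by rewrite sup0.
by apply: ge_sup => // _ [i /= ? <-]; exact: xyr.
Qed.

Let bdist_ge0 x y : 0 <= bdist x y.
Proof.
have [[i xyi]|] := pselect (exists i, sval x i != sval y i).
  by apply: le_trans (bdist_ge xyi); exact/ltW/eps_gt0.
move=> /forallNP xy; rewrite /bdist.
have -> : [set eps R i | i in [set i | sval x i != sval y i]] = set0.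
  by apply/seteqP; split=> // r [i /xy].
by rewrite sup0.
Qed.

Let bdistxx x : bdist x x = 0.
Proof.
by apply/eqP; rewrite eq_le bdist_ge0 andbT bdist_le// => i; rewrite eqxx.
Qed.

Let bdist_positivity x y : bdist x y = 0 -> x = y.
Proof.
move=> xy; apply: eq_sig_hprop; first by move=> ? ? ?; exact: Prop_irrelevance.
apply/funext => i; apply/eqP; apply: contrapT => /negP/bdist_ge.
by rewrite xy leNgt eps_gt0.
Qed.

Let bdist_sym x y : bdist x y = bdist y x.
Proof.
by rewrite /bdist; congr (sup (image _ _)); apply/seteqP; split=> i /=; rewrite eq_sym.
Qed.

Let bdist_triangle y x z : bdist x z <= bdist x y + bdist y z.
Proof.
apply: bdist_le => [|i xz]; first exact: addr_ge0.
have [xy|xy] := eqVneq (sval x i) (sval y i).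
  by rewrite ler_wpDl// bdist_ge// -xy.
by rewrite ler_wpDr// bdist_ge.
Qed.

HB.instance Definition _ := isMetric.Build R (bsubspace R F)
  bdistxx bdist_positivity bdist_sym bdist_triangle.

Lemma bsubspace_ballE (x y : Q) d : ball x d y = (bdist x y < d) :> Prop.
Proof. by rewrite ballEmdist. Qed.

Lemma bsubspace_ball_agree (x y : Q) k : ball x (eps R k) y ->
  forall i, (i < k.+1)%N -> sval x i = sval y i.
Proof.
rewrite bsubspace_ballE => xy i ik; apply/eqP; apply: contrapT => /negP/bdist_ge.
by move=> /le_lt_trans/(_ xy); rewrite ltNge eps_le.
Qed.

Lemma agree_bsubspace_ball (x y : Q) k d : eps R k < d ->
  (forall i, (i < k.+1)%N -> sval x i = sval y i) -> ball x d y.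
Proof.
move=> kd xy; rewrite bsubspace_ballE; apply: le_lt_trans kd.
apply: bdist_le => [|i]; first exact/ltW/eps_gt0.
by have [ik|ki _] := ltnP i k.+1; [rewrite xy ?eqxx|rewrite eps_le// ltnW].
Qed.

Lemma bsubspace_complete : bclosed F -> complete_space Q.
Proof.
move=> Fc G PG /cauchy_ballP Gc.
have /choice[p pG] : forall k, exists x, G (ball x (eps R k)).
  move=> k; have := Gc _ (eps_gt0 R k).
  by move=> /nearP_dep/filter_ex[x xG]; exists x.
(* The ball of radius [eps R k] fixes the coordinates up to [k], so the diagonal reads off the
   limit. *)
pose l : baire := fun i => sval (p i) i.
have pl k i : (i < k.+1)%N -> sval (p k) i = l i.
  move=> ik; have [y [yi yk]] := filter_ex (filterI (pG i) (pG k)).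
  by rewrite (bsubspace_ball_agree yk ik) /l (bsubspace_ball_agree yi).
have Fl : F l.
  apply: (Fc (fun k => sval (p k))); last by move=> k; exact: svalP.
  by apply: bcvg_agree => n i ni; apply: pl; rewrite ltnW.
exists (exist _ l Fl).
move=> A /nbhs_ballP[d /= d0 dA]; have [k kd] := eps_lt d0.
apply: filterS (pG k) => y py; apply: dA.
apply: (agree_bsubspace_ball kd) => i ik /=.
by rewrite -(pl k)// (bsubspace_ball_agree py).
Qed.

Lemma bsubspace_separable : separable Q.
Proof.
have [[v0]|nQ] := pselect (exists v0 : Q, True); last first.
  by exists set0; [exact: countable0|move=> O [x _]; case: nQ; exists x].
move=> _; pose pk (s : seq nat) : Q :=
  xget v0 [set v | forall i, (i < size s)%N -> sval v i = nth 0%N s i].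
exists (range pk); first exact: sub_countable (card_image_le _ _) (countableP _).
move=> O [x Ox] Oo; have /nbhs_ballP[d /= d0 dO] : nbhs x O by exact: open_nbhs_nbhs.
have [k kd] := eps_lt d0.
exists (pk (mkseq (sval x) k.+1)); split; last by exists (mkseq (sval x) k.+1).
apply: dO; apply: (agree_bsubspace_ball kd) => i ik; rewrite /pk.
case: xgetP => [v _ vP|/(_ x)]; first by rewrite vP ?size_mkseq ?nth_mkseq.
by case=> j; rewrite size_mkseq => jk; rewrite nth_mkseq.
Qed.

End baire_subspace.

Lemma bopen_preimage (M : topologicalType) (g : baire -> M) (U : set M) :
  (forall u z, bcvg u z -> g (u n) @[n --> \oo] --> g z) ->
  open U -> bclosed (~` (g @^-1` U)).
Proof.
move=> gc oU u z uz gu; apply: (@closed_cvg _ _ _ _ _ (~` U)) (gc u z uz).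
  exact: open_closedC.
exact: nearW.
Qed.

Lemma closedSubspace_inj (R : realType) (V : normedModType R) :
  injective (@subspace_set R V).
Proof.
move=> [X Xc Xs] [Y Yc Ys] /= XY; move: Xc Xs; rewrite XY => Xc Xs.
by congr ClosedSubspace; exact: Prop_irrelevance.
Qed.

(** * Dense sequences as codes of closed subspaces *)

Section codes.
Variables (R : realType) (e : nat -> C2N R).
Hypothesis ed : forall f d, 0 < d -> exists n, ball f d (e n).

Definition cseq (z : baire) (n : nat) : C2N R :=
  brep e (@C2N_fast_complete R) (bsub z n).

Lemma cseq_cvg u z n : bcvg u z -> cseq (u k) n @[k --> \oo] --> cseq z n.
Proof. by move=> uz; apply: brep_cvg; exact: bcvg_sub. Qed.

Lemma cseq_surj (x : nat -> C2N R) : exists z, forall n, cseq z n = x n.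
Proof.
have /choice[f fP] n := brep_surj (@C2N_fast_complete R) (@norm_hausdorff _ _) ed (x n).
by have [z zP] := bsub_ex f; exists z => n; rewrite /cseq zP.
Qed.

Lemma closure_ballP (V : pseudoMetricType R) (S : set V) x :
  closure S x <-> forall d, 0 < d -> exists2 y, S y & ball x d y.
Proof.
split=> [Sx d d0|Sx B /nbhs_ballP[d /= d0 dB]].
  by have [y [Sy xy]] := Sx _ (nbhsx_ballx x d d0); exists y.
by have [y Sy xy] := Sx _ d0; exists y; split=> //; exact: dB.
Qed.

(** These balls form a countable basis, so equality of closures becomes a countable family of
    equivalences. *)
Lemma meets_sub (X Y : set (C2N R)) :
  (forall i j, X `&` ball (e i) (eps R j) !=set0 -> Y `&` ball (e i) (eps R j) !=set0) ->
  X `<=` closure Y.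
Proof.
move=> XY x Xx; apply/closure_ballP => d d0.
have [j jd] := @eps_lt R (d / 2) ltac:(by rewrite divr_gt0).
have [i xi] := ed x (eps_gt0 R j).
have [|y [Yy iy]] := XY i j; first by exists x; split=> //; exact: ball_sym.
by exists y => //; apply: le_ball (ball_triangle xi iy); lra.
Qed.

Lemma closure_meets (Y U : set (C2N R)) : open U ->
  closure Y `&` U !=set0 -> Y `&` U !=set0.
Proof. by move=> oU [x [Yx Ux]]; apply: Yx; exact: open_nbhs_nbhs. Qed.

(** The parametrizing standard Borel space is the closed set [F] that projects onto [P]. The map to
    subspaces is Borel because the closure of a sequence meets an open set iff some term lies in it,
    which is an open condition on the code. *)
Lemma analytic_of_codes (A : set (SB R)) (P : set baire) (y : baire -> nat -> C2N R) :
  banalytic P ->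
  (forall u z n, bcvg u z -> y (u k) n @[k --> \oo] --> y z n) ->
  (forall z, P z -> exists2 Y : SB R, A Y & (Y : set _) = closure (range (y z))) ->
  (forall Y : SB R, A Y -> exists2 z, P z & (Y : set _) = closure (range (y z))) ->
  analytic R A.
Proof.
move=> [F Fc FP] yc PA AP.
pose Q := bsubspace R F.
have /choice[g gP] : forall v : Q, exists Y : SB R,
    A Y /\ (Y : set _) = closure (range (y (beven (sval v)))).
  move=> v; have [|Y AY Yy] := PA (beven (sval v)).
    by apply/FP; exists (bodd (sval v)); rewrite bjoinK; exact: svalP.
  by exists Y.
exists Q, (@borel Q), g; split.
- exists Q, id; split => //.
  + exact: bsubspace_separable.
  + exact: bsubspace_complete.
  + by exists id.
- apply: smallest_sub.
    split.
    + by rewrite preimage_set0; have [] := smallest_sigma_algebra setT (@open Q).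
    + move=> B; rewrite !setTD preimage_setC -setTD.
      by have [_ + _] := smallest_sigma_algebra setT (@open Q); apply.
    + move=> B gB; rewrite preimage_bigcup.
      by have [_ _] := smallest_sigma_algebra setT (@open Q); apply.
  move=> _ [U oU <-]; apply: sub_sigma_algebra.
  rewrite (_ : _ @^-1` _ = \bigcup_n [set v : Q | U (y (beven (sval v)) n)]); last first.
    apply/seteqP; split=> v /=; have [_ ->] := gP v.
      by move=> /(closure_meets oU)[_ [[n _ <-] Un]]; exists n.
    move=> [n _ Un]; exists (y (beven (sval v)) n); split=> //.
    by apply: subset_closure; exists n.
  apply: bigcup_open => n _.
  rewrite openE => v Uv.
  apply: contrapT => nU.
  have /choice[u uP] : forall k, exists w : Q, ball v (eps R k) w /\
      ~ U (y (beven (sval w)) n).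
    move=> k; apply: contrapT => /forallNP kU; apply: nU.
    apply/nbhs_ballP; exists (eps R k); first exact: eps_gt0.
    move=> w vw; apply: contrapT => nw; exact: (kU w).
  have uc : bcvg (fun k => beven (sval (u k))) (beven (sval v)).
    apply: bcvg_even; apply: bcvg_agree => k i ik.
    by have := bsubspace_ball_agree (uP k).1 (ltnW ik) => ->.
  have := yc _ _ n uc => /(_ U (open_nbhs_nbhs _))[//|k _ kU].
  by apply: (uP k).2; apply: kU => /=.
- apply/seteqP; split=> [Y AY|_ [v _ <-]]; last by have [] := gP v.
  have [z /FP[w Fw] Yz] := AP Y AY.
  exists (exist _ _ Fw : Q) => //.
  case: (gP (exist _ _ Fw : Q)) => _; rewrite /= bevenK -Yz.
  exact: closedSubspace_inj.
Qed.

(** Carrying the complement along makes the family of such sets a sigma-algebra. *)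
Lemma borel_analytic_codes (M : pseudoMetricType R) (e' : nat -> M)
    (Mc : fast_complete M) (D : set M) : borel D ->
  banalytic (brep e' Mc @^-1` D) /\ banalytic (~` (brep e' Mc @^-1` D)).
Proof.
pose G := [set D | banalytic (brep e' Mc @^-1` D) /\
                   banalytic (~` (brep e' Mc @^-1` D))].
suff : <<s @open M >> `<=` G by apply.
apply: smallest_sub; last first.
  move=> U oU; have Uc := bopen_preimage (@brep_cvg R M e' Mc) oU.
  by split; [exact: bopen_analytic|exact: bclosed_analytic].
split.
- rewrite /G /= preimage_set0 setC0.
  by split; apply: bclosed_analytic => // u z _ /(_ 0%N).
- by move=> B [B1 B2]; rewrite /G /= setTD preimage_setC setCK.
move=> B GB; rewrite /G /= preimage_bigcup setC_bigcup; split.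
  rewrite (_ : \bigcup_i _ = [set z | exists n, (brep e' Mc @^-1` B n) z]); last first.
    by apply/seteqP; split=> z /= [n]; exists n.
  by apply: banalytic_ex => n; exact: (GB n).1.
rewrite (_ : \bigcap_i _ = [set z | forall n, (~` (brep e' Mc @^-1` B n)) z]); last first.
  by apply/seteqP; split=> z /= Bz n; [exact: Bz|move=> _; exact: Bz].
by apply: banalytic_all => n; exact: (GB n).2.
Qed.

(** Points of the parameter space are named through [brep]. That [z] codes the subspace named by [v]
    means that the two meet the same basic balls, a countable conjunction of conditions on [(z, v)];
    the name [v] is then projected away. *)
Lemma codes_of_analytic (A : set (SB R)) : analytic R A ->
  banalytic [set z | exists2 X : SB R, A X & (X : set _) = closure (range (cseq z))].
Proof.
move=> [X0 [S [f [[P [h [Ps Pc [h' hK h'K] SE]]] fS ->]]]].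
(* An empty [P] has no dense sequence to feed to [brep], but then no code exists either. *)
have [[p0]|nP] := pselect (exists p : P, True); last first.
  apply: bclosed_analytic => u z _ /(_ 0%N)[X [x0 _ _] _].
  by case: nP; exists (h' x0).
move=> _; have [e' e'd] := separable_seq p0 Ps.
have Pfc := complete_fast Pc.
pose rho := brep e' Pfc.
pose U (ij : nat * nat) := ball (e ij.1) (eps R ij.2).
pose H (ij : nat * nat) := [set v | f (h (rho v)) `&` U ij !=set0].
have oU ij : open (U ij) by exact: ball_open.
have Ha ij : banalytic (H ij) /\ banalytic (~` H ij).
  apply: (borel_analytic_codes e' Pfc (D := [set p | f (h p) `&` U ij !=set0])).
  apply/(SE (f @^-1` [set X : SB R | X `&` U ij !=set0])); apply: fS.
  apply: sub_sigma_algebra. by exists (U ij); first exact: oU.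
pose K (ij : nat * nat) := [set z | exists n, U ij (cseq z n)].
(* The equivalence of [H] and [K] is written as a disjunction, each of the two sets being analytic
   together with its complement. *)
pose L (ij : nat * nat) := [set t | (H ij (bodd t) /\ K ij (beven t)) \/
                      (~ H ij (bodd t) /\ ~ K ij (beven t))].
have La ij : banalytic (L ij).
  have Uc n : bclosed (~` [set z | U ij (cseq z n)]).
    by apply: (@bopen_preimage _ (cseq ^~ n)) => // u z uz; exact: cseq_cvg.
  have Ka : banalytic (K ij).
    by apply: banalytic_ex => n; exact: bopen_analytic (Uc n).
  have nKa : banalytic (~` K ij).
    rewrite (_ : ~` _ = [set z | forall n, ~ U ij (cseq z n)]).
      by apply: banalytic_all => n; exact: bclosed_analytic (Uc n).
    by apply/seteqP; split=> z /= /forallNP.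
  apply: banalytic_or; apply: banalytic_and.
  - by apply: (banalytic_reindex (g := bodd)) (Ha ij).1 => u z; exact: bcvg_odd.
  - by apply: (banalytic_reindex (g := beven)) Ka => u z; exact: bcvg_even.
  - by apply: (banalytic_reindex (g := bodd)) (Ha ij).2 => u z; exact: bcvg_odd.
  - by apply: (banalytic_reindex (g := beven)) nKa => u z; exact: bcvg_even.
rewrite (_ : [set _ | _] =
    [set z | exists v, [set t | forall ij, L ij t] (bjoin z v)]); last first.
  have rangeE z ij : K ij z <-> range (cseq z) `&` U ij !=set0.
    by split=> [[n]|[_ [[n _ <-]]]]; [exists (cseq z n); split=> //; exists n|exists n].
  apply/seteqP; split=> z /=.
    move=> [X [x0 _ x0X] fx0]; rewrite -x0X in fx0.
    have [v vP] := brep_surj Pfc (@metric_hausdorff _ _) e'd (h' x0).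
    exists v => ij; rewrite /L /= bevenK boddK.
    have HK : H ij v <-> K ij z.
      rewrite rangeE /H /= /rho vP h'K fx0.
      split; first by apply: closure_meets; exact: oU.
      by move=> [y [yr Uy]]; exists y; split=> //; exact: subset_closure.
    by have [/[dup] ? /HK|/[dup] ? nH] := pselect (H ij v); [left|right; split=> // /HK].
  move=> [v vL]; exists (f (h (rho v))); first by exists (h (rho v)).
  have HK ij : H ij v <-> K ij z.
    by have := vL ij; rewrite /L /= bevenK boddK => -[[]|[]].
  apply/seteqP; split.
    by apply: meets_sub => i j /(HK (i, j))/rangeE.
  rewrite (iffLR (closure_id _) (@subspace_closed _ _ (f (h (rho v))))).
  move=> x /closure_ballP xz; apply/closure_ballP => d d0.
  have [y [n _ <-] xy] := xz (d / 2) ltac:(by rewrite divr_gt0).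
  have : range (cseq z) `<=` closure (f (h (rho v)) : set _).
    apply: meets_sub => i j [w [wr wU]]; apply: (HK (i, j)).2.
    by apply/rangeE; exists w.
  move=> /(_ (cseq z n) ltac:(by exists n))/closure_ballP.
  move=> /(_ (d / 2) ltac:(by rewrite divr_gt0))[w wX nw].
  by exists w => //; apply: le_ball (ball_triangle xy nw); lra.
by apply: banalytic_proj; exact: banalytic_all.
Qed.

End codes.

(** * Trees of separated cells in dual balls *)

Lemma subspace_val_comb (R : realType) (V : normedModType R)
    (X : closedSubspace V) (u v w : subspace_space X) (a : R) :
  val (u + a *: v - w) = val u + a *: val v - val w.
Proof. by []. Qed.

Section functionals_on_sequence.
Variable R : realType.
Implicit Types (x : nat -> C2N R) (phi : nat -> R) (k : nat).

(* When [x] enumerates a dense subset of a subspace [X], these are the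
restrictions to [x] of the functionals on [X] of norm at most [k]. *)
Definition dual_ball k x : set (nat -> R) :=
  [set phi | forall i j l (c : rat),
    `|phi i + ratr c * phi j - phi l| <= k%:R * `|x i + ratr c *: x j - x l|].

Lemma dense_subspace_seq (X : closedSubspace (C2N R)) x :
  (X : set _) = closure (range x) ->
  exists xs : nat -> subspace_space X, (forall n, val (xs n) = x n) /\ dense_seq xs.
Proof.
move=> Xx; have xX n : x n \in subspace_pred X.
  by rewrite inE Xx; apply: subset_closure; exists n.
exists (fun n => exist _ (x n) (xX n)); split=> // u d d0.
have := valP u; rewrite inE Xx => /closure_ballP/(_ d d0)[_ [n _ <-]].
by rewrite -ball_normE => ux; exists n.
Qed.

Section restriction.
Variables (X : closedSubspace (C2N R)) (x : nat -> C2N R).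
Variables (xs : nat -> subspace_space X).
Hypothesis xsE : forall n, val (xs n) = x n.
Hypothesis xsd : dense_seq xs.

Let xs_norm i j l (c : rat) : `|x i + ratr c *: x j - x l| =
  `|xs i + ratr c *: xs j - xs l|.
Proof. by rewrite subspace_normE subspace_val_comb !xsE. Qed.

Lemma dual_ball_ex k phi : dual_ball k x phi ->
  exists f : dual (subspace_space X), forall n, f (xs n) = phi n.
Proof.
move=> phiK.
have [|f [flin fx fM]] := @dense_extension R (subspace_space X) R^o xs phi k%:R
    (@real_fast_complete R) xsd (ler0n _ _).
  by move=> i j l c; rewrite -xs_norm; exact: phiK.
have [F FE] := dual_ex flin fM.
by exists F => n; rewrite FE fx.
Qed.

Lemma dual_ball_dual k (f : dual (subspace_space X)) : `|f| <= k%:R ->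
  dual_ball k x (f \o xs).
Proof.
move=> fk i j l c /=; rewrite -dual_comb.
by rewrite xs_norm (le_trans (dual_norm_ge _ _))// ler_wpM2r.
Qed.

End restriction.

Lemma dual_ball_bound k x phi : dual_ball k x phi ->
  forall m, `|phi m| <= k%:R * `|x m|.
Proof.
move=> phiK m; have := phiK m m m 1.
by rewrite rmorph1 mul1r scale1r !addrK.
Qed.

(** Weak-star compactness of the dual ball when the space itself moves with [n]: convergence of
    [u n m] bounds [phi n m] eventually by [k (|x m| + 1)], and the inequalities defining the ball
    pass to the limit. *)
Lemma dual_ball_limit k (u : nat -> nat -> C2N R) x (phi : nat -> nat -> R) :
  (forall m, u n m @[n --> \oo] --> x m) ->
  (forall n, dual_ball k (u n) (phi n)) ->
  exists F : set_system nat, [/\ ProperFilter F, \oo `<=` F & exists2 psi,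
    dual_ball k x psi & forall m, phi n m @[n --> F] --> (psi m : R)].
Proof.
move=> ux uphi.
have [|F [PF oF [psi psiF]]] := @bounded_ultra_cvg R phi (fun m => k%:R * (`|x m| + 1)).
  move=> m; have /cvgrPdist_lt/(_ 1 ltr01) := ux m; apply: filterS => n xn.
  apply: le_trans (dual_ball_bound (uphi n) m) _.
  rewrite ler_wpM2l// -lerBlDl (le_trans _ (ltW xn))//.
  by rewrite distrC lerB_dist.
exists F; split=> //; exists psi => // i j l c.
have uF m : u n m @[n --> F] --> x m by move=> N /(ux m) /oF.
apply: (@ler_cvg_to _ F _ R
  (fun n => `|phi n i + ratr c * phi n j - phi n l|)
  (fun n => k%:R * `|u n i + ratr c *: u n j - u n l|)).
- by apply: cvg_norm; apply: cvgB => //; apply: cvgD => //; exact: cvgMl_tmp.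
- by apply: cvgMl_tmp; apply: cvg_norm; apply: cvgB => //; apply: cvgD => //; exact: cvgZl_tmp.
- by apply: nearW => n; exact: uphi.
Qed.

(* [(m, q, b)] stands for the half-space [phi m < q], or [q < phi m] if [b]. *)
Definition halfspaces := seq (nat * rat * bool).

Definition inhs (V : halfspaces) phi := forall c, c \in V ->
  if c.2 then ratr c.1.2 < phi c.1.1 else phi c.1.1 < ratr c.1.2.

(** The closed counterpart of [inhs], stable under limits; a positive [d] gives back the strict
    inequalities, and [d = 0] the closed half-spaces. *)
Definition inhs_margin (d : R) (V : halfspaces) phi := forall c, c \in V ->
  if c.2 then ratr c.1.2 + d <= phi c.1.1 else phi c.1.1 <= ratr c.1.2 - d.

Lemma inhs_margin_limit (F : set_system nat) (phi : nat -> nat -> R) psi d V :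
  ProperFilter F -> (forall m, phi n m @[n --> F] --> (psi m : R)) ->
  F [set n | inhs_margin d V (phi n)] -> inhs_margin d V psi.
Proof.
move=> PF phiF FV [[m q] [] /=] cV /=; rewrite /=.
- apply: cvgr_to_ge (phiF m) _; apply: filterS FV => n /(_ _ cV); exact.
- apply: cvgr_to_le (phiF m) _; apply: filterS FV => n /(_ _ cV); exact.
Qed.

Lemma inhs_marginW V phi : inhs V phi -> inhs_margin 0 V phi.
Proof.
move=> Vphi c /Vphi; rewrite addr0 subr0.
by case: ifP => _ /ltW.
Qed.

Lemma inhs_margin_gt0 d V phi : 0 < d -> inhs_margin d V phi -> inhs V phi.
Proof. by move=> d0 Vphi c /Vphi; case: ifP => _; lra. Qed.

Lemma inhs_ex_margin V phi : inhs V phi -> exists d, inhs_margin (eps R d) V phi.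
Proof.
elim: V => [|[[m q] b] V IH] Vphi; first by exists 0%N.
have [|d dV] := IH; first by move=> c cV; apply: Vphi; rewrite inE cV orbT.
have [d' d'V] : exists d', if b then ratr q + eps R d' <= phi m else phi m <= ratr q - eps R d'.
  have := Vphi (m, q, b) (mem_head _ _); case: b {Vphi} => /= qm.
    by have [d' d'q] := @eps_lt R (phi m - ratr q) ltac:(lra); exists d'; lra.
  by have [d' d'q] := @eps_lt R (ratr q - phi m) ltac:(lra); exists d'; lra.
exists (maxn d d') => c; have e1 := eps_le R (leq_maxl d d').
have e2 := eps_le R (leq_maxr d d').
rewrite inE => /predU1P[->/=|/dV]; last by case: ifP => _; lra.
by case: b d'V {Vphi}; lra.
Qed.

Lemma inhs_marginS d d' V (phi : nat -> R) : d' <= d ->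
  inhs_margin d V phi -> inhs_margin d' V phi.
Proof. by move=> dd' Vphi c /Vphi; case: ifP => _; lra. Qed.

Lemma inhs_limit (F : set_system nat) (phi : nat -> nat -> R) psi V :
  ProperFilter F -> (forall m, phi n m @[n --> F] --> (psi m : R)) ->
  inhs V psi -> F [set n | inhs V (phi n)].
Proof.
move=> PF phiF; elim: V => [|[[m q] b] V IH] Vpsi; first by apply: filterS filterT.
have FV : F [set n | inhs V (phi n)].
  by apply: IH => c cV; apply: Vpsi; rewrite inE cV orbT.
have Fm : F [set n | if b then ratr q < phi n m else phi n m < ratr q].
  have := Vpsi (m, q, b) (mem_head _ _) => /=.
  by case: b {Vpsi} => ?; [exact: (cvgr_gt _ (phiF m))|exact: (cvgr_lt _ (phiF m))].
apply: filterS2 Fm FV => n /= mn Vn c; rewrite inE => /predU1P[->//|]; exact: Vn.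
Qed.

End functionals_on_sequence.

(* Heap order on the nodes of the full binary tree, a node being the list of
turns leading to it, the last turn first. *)
Fixpoint heap (s : seq bool) : nat :=
  if s is b :: s' then ((heap s').*2.+1 + b)%N else 0%N.

Lemma heap_inj : injective heap.
Proof.
elim=> [|b s IH] [|b' s'] //=.
move=> H; have bb' : b = b' by case: b H; case: b' => //=; lia.
by subst b'; congr cons; apply: IH; lia.
Qed.

Lemma heap_surj n : exists s, heap s = n.
Proof.
have [m] := ubnP n; elim: m n => // m IH [|n] nm; first by exists [::].
have [|s sn] := IH n./2; first by lia.
by exists (odd n :: s); rewrite /= sn; lia.
Qed.

(** A single index [k] drives both the radius of the dual ball and the precision [1 / (k + 1)]:
    large [k] serves any functional and any error. *)
Definition gap (k : nat) : rat := k.+1%:R^-1.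

Lemma gap_gt0 (R : realType) k : 0 < ratr (gap k) :> R.
Proof. by rewrite ltr0q invr_gt0 ltr0n. Qed.

Section separation_tree.
Variable R : realType.

(** A label [(m, q)] cuts the cell of its node into [phi m < q] and [q + g < phi m], so the two
    halves differ by [g] at the coordinate [m]. *)
Fixpoint split_cell (lab : nat -> nat * rat) (g : rat) (s : seq bool) : halfspaces :=
  if s is b :: s' then
    ((lab (heap s')).1, (lab (heap s')).2 + (if b then g else 0), b)
      :: split_cell lab g s'
  else [::].

(** The cell of [s] uses the labels of its proper ancestors only, and among these the parent comes
    last in heap order. *)
Definition labelled (n : nat) (s : seq bool) :=
  if s is _ :: s' then (heap s' < n)%N else true.

(* Only the first [n] labels matter. If [lab] is separating for every [n], the
branches of the tree yield uncountably many functionals at mutual distance at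
least [gap k], so that the dual is not separable. *)
Definition separating (k : nat) (x : nat -> C2N R) lab n :=
  (forall s, labelled n s -> exists2 phi,
     dual_ball k x phi & inhs_margin 0 (split_cell lab (gap k) s) phi) /\
  (forall s, (heap s < n)%N -> `|x (lab (heap s)).1| <= 1).

Lemma heap_leS b s : (heap s < heap (b :: s))%N.
Proof. by rewrite /=; lia. Qed.

Lemma split_cell_eq lab lab' g n s : (forall i, (i < n)%N -> lab i = lab' i) ->
  labelled n s -> split_cell lab g s = split_cell lab' g s.
Proof.
move=> ll'; elim: s => [|b s IH]//= sn; rewrite ll'// IH//.
by case: s sn {IH} => //= b' s'; lia.
Qed.

Lemma labelledW n n' s : (n <= n')%N -> labelled n s -> labelled n' s.
Proof. by case: s => //= _ s nn' /leq_trans; apply. Qed.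

Lemma no_nat_injection (j : (nat -> bool) -> nat) : ~ injective j.
Proof.
move=> ji; pose b n := `[< forall c, j c = n -> ~~ c n >].
have [bj|nbj] := boolP (b (j b)); first by move/asboolP/(_ b erefl): (bj); rewrite bj.
have /negP := nbj; apply; apply/asboolP => c /ji ->; exact: nbj.
Qed.

(** Compactness gives a functional in all closed cells along a branch. Two branches are [gap k]
    apart from their first difference on, so balls of radius [gap k / 2] around a dense sequence
    would inject the branches into [nat]. *)
Lemma separable_dual_no_branch k (X : closedSubspace (C2N R)) x lab :
  (X : set _) = closure (range x) -> separable (dual (subspace_space X)) ->
  ~ forall n, separating k x lab n.
Proof.
move=> Xx /(separable_seq 0)[e ed] sep.
have [xs [xsE xsd]] := dense_subspace_seq Xx.
pose path (b : nat -> bool) := fix path n : seq bool :=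
  if n is m.+1 then b m :: path m else [::].
have /choice[phi phiP] : forall b, exists phi, dual_ball k x phi /\
    forall n, inhs_margin 0 (split_cell lab (gap k) (path b n)) phi.
  move=> b.
  have /choice[phi phiP] : forall n, exists phi, dual_ball k x phi /\
      inhs_margin 0 (split_cell lab (gap k) (path b n)) phi.
    move=> n; have [phi phiK phiV] : exists2 phi, dual_ball k x phi &
        inhs_margin 0 (split_cell lab (gap k) (path b n)) phi.
      apply: (sep (heap (path b n))).1; rewrite /labelled.
      by case: (path b n) => // b' s; exact: heap_leS.
    by exists phi.
  have [|F [PF oF [psi psiK psiF]]] := @dual_ball_limit R k (fun=> x) x phi
      (fun=> cvg_cst _).
    by move=> n; exact: (phiP n).1.
  exists psi; split=> // n; apply: inhs_margin_limit psiF _.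
  apply: oF; exists n => // N /= nN; have := (phiP N).2.
  move: (phi N) => phiN; elim: N nN => [|N IH]; first by rewrite leqn0 => /eqP ->.
  rewrite leq_eqVlt => /predU1P[->//|]; rewrite ltnS => nN VN.
  by apply: IH => // c cV; apply: VN; rewrite /= inE cV orbT.
have /choice[f fP] : forall b, exists f : dual (subspace_space X),
    forall n, f (xs n) = phi b n.
  by move=> b; apply: (dual_ball_ex xsE xsd (phiP b).1).
have g0 := gap_gt0 R k.
have /choice[j jP] : forall b, exists n, ball (f b) (ratr (gap k) / 2) (e n).
  by move=> b; apply: ed; rewrite divr_gt0.
apply: (@no_nat_injection j) => b c bc; apply: contrapT => nbc.
have [t tbc tmin] : exists2 t, b t != c t & forall i, (i < t)%N -> b i = c i.
  have : exists t, b t != c t.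
    apply: contrapT => /forallNP H; apply: nbc; apply/funext => i.
    by have /negP/negPn/eqP := H i.
  move=> /ex_minnP[t bt tmin]; exists t => // i it.
  by apply/eqP; apply: contraTT it => /tmin; rewrite -leqNgt.
have pe : path b t = path c t.
  elim: t tmin {tbc} => //= t IH tmin; rewrite tmin ?IH// => i it.
  by apply: tmin; rewrite ltnW.
pose m := (lab (heap (path b t))).1.
have dist : ratr (gap k) <= `|phi b m - phi c m|.
  have pS d : path d t.+1 = d t :: path d t by [].
  have := (phiP b).2 t.+1; have := (phiP c).2 t.+1; rewrite !pS -pe.
  move=> /(_ _ (mem_head _ _)) hc /(_ _ (mem_head _ _)); move: hc => /=.
  rewrite -/m; set q := (lab _).2.
  case: (b t) (c t) tbc => -[]//= _; rewrite !rmorphD/= rmorph0 !(addr0, subr0) => h1 h2.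
  - by rewrite (le_trans _ (ler_norm _))//; lra.
  - by rewrite distrC (le_trans _ (ler_norm _))//; lra.
have m1 : `|xs m| <= 1.
  by rewrite subspace_normE xsE; apply: (sep (heap (path b t)).+1).2.
have : `|f b - f c| < ratr (gap k).
  have := jP b; have := jP c; rewrite -bc -!ball_normE /= distrC => h1 h2.
  by rewrite (le_lt_trans (ler_distD (e (j b)) _ _))//; lra.
rewrite ltNge => /negP; apply; rewrite (le_trans dist)//.
rewrite -!fP; apply: le_trans (dual_norm_ge (f b - f c) (xs m)) _.
by rewrite ler_piMr.
Qed.

Section well_founded.
Variables (F : set baire) (x : baire -> nat -> C2N R) (k : nat).
Hypothesis Fc : bclosed F.
Hypothesis xc : forall u z n, bcvg u z -> x (u i) n @[i --> \oo] --> x z n.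

Definition tnode : Type := (nat * (nat * rat))%type.
Definition tnode0 : tnode := (0%N, (0%N, 0)).
Definition tlab (sg : seq tnode) i := (nth tnode0 sg i).2.

(* Simultaneous approximations of a code [v] and of a separating tree over
[x v]; an infinite branch yields, by compactness, a full separating tree. *)
Definition attempt (sg : seq tnode) := exists v, [/\ F v,
  forall i, (i < size sg)%N -> v i = (nth tnode0 sg i).1 &
  separating k (x v) (tlab sg) (size sg)].

Definition achild (sg' sg : seq tnode) := attempt sg' /\ exists a, sg' = rcons sg a.

Lemma achild_wf : (forall v lab, F v -> ~ forall n, separating k (x v) lab n) ->
  forall sg, Acc achild sg.
Proof.
move=> nb sg0; apply: contrapT => nA0.
have /choice[next nextP] : forall sg, exists a, ~ Acc achild sg ->
    attempt (rcons sg a) /\ ~ Acc achild (rcons sg a).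
  move=> sg; have [A|nA] := pselect (Acc achild sg); first by exists tnode0.
  suff [a aP] : exists a, attempt (rcons sg a) /\ ~ Acc achild (rcons sg a) by exists a.
  apply: contrapT => /forallNP H; apply: nA; constructor => sg' [sgW [a sga]].
  by apply: contrapT => nA'; apply: (H a); rewrite -sga.
pose sg := fix sg n := if n is m.+1 then rcons (sg m) (next (sg m)) else sg0.
have sgA n : ~ Acc achild (sg n) by elim: n => //= n IH; exact: (nextP _ IH).2.
have sgW n : attempt (sg n.+1) by exact: (nextP _ (sgA n)).1.
have sg_size n : size (sg n) = (size sg0 + n)%N.
  by elim: n => [|n IH]; rewrite ?addn0// size_rcons IH addnS.
have sg_nth n d i : (i < size (sg n))%N -> nth tnode0 (sg (n + d)%N) i = nth tnode0 (sg n) i.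
  move=> id; elim: d => [|d IH]; first by rewrite addn0.
  rewrite addnS /= nth_rcons IH ifT// (leq_trans id)// !sg_size.
  by rewrite leq_add2l leq_addr.
pose a i := nth tnode0 (sg i.+1) i.
have sga n i : (i < n)%N -> nth tnode0 (sg n) i = a i.
  move=> ni; rewrite -(subnKC ni) sg_nth// sg_size.
  by rewrite addnS ltnS leq_addl.
have sz n : (n <= size (sg n.+1))%N by rewrite sg_size addnS (leq_trans (leq_addl _ _) (leqnSn _)).
have /choice[v vP] := sgW.
pose z : baire := fun i => (a i).1.
have vz : bcvg v z.
  apply: bcvg_agree => n i ni; have [_ vn _] := vP n.
  by rewrite vn ?sga ?(leq_trans ni (sz n))// ltnS ltnW.
have Fz : F z by apply: Fc vz _ => n; have [] := vP n.
have lab_eq n i : (i < n.+1)%N -> tlab (sg n.+1) i = (a i).2.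
  by move=> ni; rewrite /tlab sga.
have sepn n m : (n <= m)%N -> forall s, labelled n s ->
    split_cell (tlab (sg m.+1)) (gap k) s = split_cell (fun i => (a i).2) (gap k) s.
  move=> nm s; apply: split_cell_eq => i ni.
  by apply: lab_eq; rewrite (leq_trans ni)// leqW.
apply: (nb z (fun i => (a i).2) Fz) => n; split=> [s sn|s sn].
  (* From stage [n] on, the labels above [s] no longer change. The functionals live over different
     codes but in one closed cell, and have a limit over [z]. *)
  have /choice[phi phiP] : forall m, exists phi, dual_ball k (x (v (m + n)%N)) phi /\
      inhs_margin 0 (split_cell (fun i => (a i).2) (gap k) s) phi.
    move=> m; have [_ _ [+ _]] := vP (m + n)%N.
    have nm : (n <= m + n)%N by exact: leq_addl.
    move=> /(_ s)[|phi phiK]; first exact: labelledW (leq_trans nm (sz _)) sn.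
    by rewrite (sepn n)// => phiV; exists phi.
  have [|m|G [PG oG [psi psiK psiG]]] :=
      @dual_ball_limit R k (fun m => x (v (m + n)%N)) (x z) phi _.
  - by move=> m; apply: xc; exact: bcvg_shift.
  - exact: (phiP m).1.
  exists psi => //; apply: (inhs_margin_limit PG psiG); apply: oG.
  by exists 0%N => // m _; exact: (phiP m).2.
have xm := @xc _ _ (a (heap s)).2.1 vz.
apply: (@cvgr_to_le _ \oo _ _ _ _ _ (cvg_norm xm)).
exists n => // m /= nm.
have [_ _ [_ +]] := vP m; move=> /(_ s); rewrite lab_eq; last first.
  by rewrite (leq_trans sn)// leqW.
by apply; rewrite (leq_trans sn)// (leq_trans nm).
Qed.
End well_founded.
End separation_tree.

(** * The derivative along a well-founded tree *)

Section derivative.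
Variable R : realType.
Variables (F : set baire) (x : baire -> nat -> C2N R) (k : nat).
Local Notation child := (achild F x k).
Local Notation g := (ratr (gap k) : R).

Definition unit_close (y : nat -> C2N R) (r : R) (phi psi : nat -> R) :=
  forall m, `|y m| <= 1 -> `|phi m - psi m| <= r.

Section fixed_code.
Variables (v : baire) (Fv : F v).
Local Notation y := (x v).
Local Notation K := (dual_ball k y).

(** What [P] leaves of the cell has diameter at most [gap k] in the dual norm. *)
Definition removable (P : (nat -> R) -> Prop) (V : halfspaces) :=
  forall psi psi', K psi -> K psi' -> inhs V psi -> inhs V psi' ->
  [\/ unit_close y g psi psi', P psi | P psi'].

(* [removed sg] is the part of the dual ball that has been discarded after
stage [sg] of a Cantor-Bendixson style derivative, where cells of diameter at
most [gap k] are discarded and the role of the ordinal stages is played by the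
nodes of a well-founded tree. *)
Inductive removed (sg : seq tnode) (phi : nat -> R) : Prop :=
  Removed (P : (nat -> R) -> Prop) (V : halfspaces)
    (_ : forall psi, P psi -> exists2 sg', child sg' sg & removed sg' psi)
    (_ : inhs V phi) (_ : removable P V).

Lemma removedW sg sg' phi : child sg' sg -> removed sg' phi -> removed sg phi.
Proof.
move=> sgsg' [P V Pr Vphi VP].
apply: (@Removed _ _ (removed sg') V) => //; first by move=> psi ?; exists sg'.
move=> psi psi' Kpsi Kpsi' Vpsi Vpsi'; apply: Or32.
exact: Removed Pr Vpsi VP.
Qed.

(** Take for [P] all that the children discard. If no pair outside [P] were more than the gap apart,
    [V] would be removable and [phi] discarded with it; a rational then fits between the values of
    such a pair. *)
Lemma not_removed_split sg phi V : ~ removed sg phi -> K phi -> inhs V phi ->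
  exists m (q : rat) psi psi', [/\ `|y m| <= 1,
    [/\ K psi, inhs V psi & psi m < ratr q],
    [/\ K psi', inhs V psi' & ratr q + g < psi' m] &
    forall sg', child sg' sg -> ~ removed sg' psi /\ ~ removed sg' psi'].
Proof.
move=> nr Kphi Vphi; apply: contrapT => H; apply: nr.
pose P psi := exists2 sg', child sg' sg & removed sg' psi.
apply: (@Removed _ _ P V) => // psi psi' Kpsi Kpsi' Vpsi Vpsi'.
have [P1|nP1] := pselect (P psi); first exact: Or32.
have [P2|nP2] := pselect (P psi'); first exact: Or33.
apply: Or31 => m m1; rewrite leNgt; apply/negP => gm; apply: H.
have nr sg' : child sg' sg -> ~ removed sg' psi /\ ~ removed sg' psi'.
  by move=> c; split=> r; [apply: nP1|apply: nP2]; exists sg'.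
have [le|lt] := leP (psi m) (psi' m).
  have [q] := @rat_in_itvoo R (psi m) (psi' m - g)
    ltac:(by move: gm; rewrite ler0_norm ?subr_le0//; lra).
  rewrite in_itv /= => /andP[q1 q2].
  by exists m, q, psi, psi'; split=> //; split=> //; lra.
have [q] := @rat_in_itvoo R (psi' m) (psi m - g)
  ltac:(by move: gm; rewrite gtr0_norm ?subr_gt0//; lra).
rewrite in_itv /= => /andP[q1 q2].
exists m, q, psi', psi; split=> //; [by split=> //; lra|].
by move=> sg' /nr[].
Qed.

(** If every cell of the tree has a survivor, the next node can be labelled by [not_removed_split].
    The longer tree is an attempt, witnessed by [v] itself, and all its cells have survivors at this
    child of [sg]; well-foundedness forbids to go on forever. *)
Lemma removed_some sg : Acc child sg -> forall lab n,
  sg = mkseq (fun i => (v i, lab i)) n -> separating k y lab n ->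
  ~ forall s, labelled n s -> exists phi,
      [/\ K phi, inhs (split_cell lab (gap k) s) phi & ~ removed sg phi].
Proof.
elim=> {}sg _ IH lab n sgE [sep1 sep2] all.
(* Labels are given in heap order, so the next one belongs to the node of index [n], whose cell is
   already determined. *)
have [s0 s0n] := heap_surj n.
have ls0 : labelled n s0 by rewrite -s0n; case: (s0) => // b s; exact: heap_leS.
have [phi0 [K0 V0 nr0]] := all s0 ls0.
have [m [q [psi [psi' [m1 [Kpsi Vpsi psiq] [Kpsi' Vpsi' psi'q] nr]]]]] :=
  not_removed_split nr0 K0 V0.
pose lab' i := if i == n then (m, q) else lab i.
have labE i : (i < n)%N -> lab i = lab' i by move=> i_n; rewrite /lab' ltn_eqF.
pose sg' := mkseq (fun i => (v i, lab' i)) n.+1.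
have sg'E : sg' = rcons sg (v n, (m, q)).
  rewrite /sg' /mkseq -addn1 iotaD map_cat /= cats1 add0n /lab' eqxx sgE.
  congr (rcons _ _); apply/eq_in_map => i; rewrite mem_iota /= add0n => i_n.
  by rewrite ltn_eqF.
have sg_child : attempt F x k sg' -> child sg' sg.
  by split=> //; exists (v n, (m, q)).
(* the cells of the extended tree, before one knows that it is an attempt *)
have cells s : labelled n.+1 s -> exists phi,
    [/\ K phi, inhs (split_cell lab' (gap k) s) phi &
        child sg' sg -> ~ removed sg' phi].
  move=> sn; have [sn'|sn'] := boolP (labelled n s).
    rewrite -(split_cell_eq (gap k) labE sn').
    (* An old cell keeps its survivor of [sg]: by [removedW] it also survives at the child. *)
    have [phi [? ? nrphi]] := all s sn'.
    by exists phi; split=> // c /(removedW c).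
  case: s sn sn' => // b s /= sn; rewrite -leqNgt => ns.
  have {ns sn}sn : heap s = n by apply/eqP; rewrite eqn_leq ns andbT -ltnS.
  have {s sn}-> : s = s0 by apply: heap_inj; rewrite sn s0n.
  rewrite -(split_cell_eq (gap k) labE ls0) s0n {1 2}/lab' eqxx /=.
  exists (if b then psi' else psi).
  split; [by case: b| |by move=> /nr[? ?]; case: b].
  move=> c; rewrite inE => /predU1P[->/=|].
    by case: b => /=; rewrite ?addr0// rmorphD.
  by move=> cV; case: b; [exact: Vpsi'|exact: Vpsi].
have sep' : separating k y lab' n.+1.
  split=> [s /cells[phi [? /inhs_marginW ? _]]|s]; first by exists phi.
  rewrite ltnS leq_eqVlt => /predU1P[->|sn]; first by rewrite /lab' eqxx.
  by rewrite -labE//; exact: sep2.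
have sg'A : child sg' sg.
  apply: sg_child; exists v; split=> //.
    by move=> i; rewrite size_mkseq => i_n; rewrite nth_mkseq.
  rewrite size_mkseq; split=> s sn.
    have [phi ? ?] := sep'.1 s sn; exists phi => //.
    rewrite (@split_cell_eq (tlab sg') lab' _ n.+1)// => i i_n.
    by rewrite /tlab nth_mkseq.
  by rewrite /tlab nth_mkseq//; exact: sep'.2.
apply: (IH _ sg'A lab' n.+1) => // s /cells[phi [? ? /(_ sg'A)]].
by exists phi.
Qed.

Lemma removed_all : (forall sg, Acc child sg) ->
  forall phi, K phi -> removed [::] phi.
Proof.
move=> wf phi Kphi; apply: contrapT => nr.
apply: (@removed_some [::] (wf _) (fun=> (0%N, 0)) 0%N erefl); last first.
  by case=> // _; exists phi.
by split=> // -[|//] _; exists phi.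
Qed.

End fixed_code.
End derivative.

(** * Witnesses of density in the dual *)

Section cover.
Variable R : realType.
Variable (k : nat) (child : seq tnode -> seq tnode -> Prop).
Local Notation g := (ratr (gap k) : R).
Implicit Types (y : nat -> C2N R) (ph : nat -> nat -> R).
Implicit Types (N : seq tnode * halfspaces -> nat).

(* [N (sg, V)] is [0] when the cell [V] is not discarded at stage [sg], and
otherwise the successor of the index of the centre of a ball containing what is
left of [V] at that stage. *)
Definition uncovered_root y N := exists2 psi, dual_ball k y psi &
  forall V, N ([::], V) <> 0%N -> ~ inhs V psi.

(** The margin [eps R d] makes the conditions on [psi] closed, and avoiding the open cells [V'] is
    closed as well; ranging over all [d] recovers the strict inequalities. *)
Definition uncovered_cell y N sg V (c : nat -> R) m d := exists psi,
  [/\ dual_ball k y psi, inhs_margin (eps R d) V psi,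
      forall sg' V', child sg' sg -> N (sg', V') <> 0%N -> ~ inhs V' psi &
      `|y m| <= 1 /\ 2 * g + eps R d <= `|psi m - c m|].

Definition covering y ph N := ~ uncovered_root y N /\ forall sgV,
  N sgV = 0%N \/ exists n, N sgV = n.+1 /\
    forall md, ~ uncovered_cell y N sgV.1 sgV.2 (ph n) md.1 md.2.

(** In a cell discarded at [sg], [psi] is near the centre or else lies in a cell discarded at a
    child of [sg]; the descent ends by well-foundedness. *)
Lemma covering_close y ph N : (forall sg, Acc child sg) -> covering y ph N ->
  forall psi, dual_ball k y psi -> exists n, unit_close y (2 * g) psi (ph n).
Proof.
move=> wf [root cell] psi Kpsi.
have [V [NV Vpsi]] : exists V, N ([::], V) <> 0%N /\ inhs V psi.
  apply: contrapT => /forallNP H; apply: root; exists psi => // V NV Vpsi.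
  exact: (H V).
elim: (wf [::]) V NV Vpsi => sg _ IH V NV Vpsi.
have [//|[n [Nn nc]]] := cell (sg, V).
have [cl|ncl] := pselect (unit_close y (2 * g) psi (ph n)); first by exists n.
have [m [m1 gm]] : exists m, `|y m| <= 1 /\ 2 * g < `|psi m - ph n m|.
  apply: contrapT => /forallNP H; apply: ncl => m m1.
  by rewrite leNgt; apply/negP => gm; apply: (H m).
have [d dV] := inhs_ex_margin Vpsi.
have [d' d'm] := @eps_lt R (`|psi m - ph n m| - 2 * g) ltac:(lra).
have [sg' [V' [c NV' V'psi]]] : exists sg' V',
    [/\ child sg' sg, N (sg', V') <> 0%N & inhs V' psi].
  apply: contrapT => H; apply: (nc (m, maxn d d')); exists psi; split=> //=.
  - by apply: inhs_marginS dV; exact/eps_le/leq_maxl.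
  - by move=> sg' V' c NV' V'psi; apply: H; exists sg', V'.
  - by split=> //; have := eps_le R (leq_maxr d d'); lra.
exact: (IH sg' c V').
Qed.

Section existence.
Variables (F : set baire) (x : baire -> nat -> C2N R) (v : baire).
Hypothesis childE : child = achild F x k.

(** The centre for a removable cell is a [ph n] within the gap of one survivor [psi0]; every other
    survivor is within the gap of [psi0], hence within [2 * g] of the centre. *)
Lemma covering_ex ph :
  (forall psi, dual_ball k (x v) psi -> removed F x k v [::] psi) ->
  (forall psi, dual_ball k (x v) psi -> exists n, unit_close (x v) g psi (ph n)) ->
  exists N, covering (x v) ph N.
Proof.
move=> rem clo.
pose P sg psi := exists2 sg', child sg' sg & removed F x k v sg' psi.
pose O (sgV : seq tnode * halfspaces) := removable x k v (P sgV.1) sgV.2.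
have /choice[c cP] : forall sgV, exists n, O sgV ->
    forall psi, dual_ball k (x v) psi -> inhs sgV.2 psi ->
    P sgV.1 psi \/ unit_close (x v) (2 * g) psi (ph n).
  move=> [sg V]; have [OV|nO] := pselect (O (sg, V)); last by exists 0%N.
  have [[psi0 [K0 V0 n0]]|H] := pselect (exists psi0,
      [/\ dual_ball k (x v) psi0, inhs V psi0 & ~ P sg psi0]); last first.
    exists 0%N => _ psi Kpsi Vpsi; left; apply: contrapT => nP.
    by apply: H; exists psi.
  have [n n0c] := clo psi0 K0; exists n => _ psi Kpsi Vpsi.
  have [|//|//] := OV psi psi0 Kpsi K0 Vpsi V0; [right=> m m1|by left].
  rewrite (le_trans (ler_distD (psi0 m) _ _))//.
  by have := n0c m m1; have := p m m1; lra.
pose N sgV := if `[< O sgV >] then (c sgV).+1 else 0%N.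
have remN sg psi : removed F x k v sg psi -> exists V, N (sg, V) <> 0%N /\ inhs V psi.
  move=> [Q V Qr Vpsi QV]; exists V; split=> //.
  rewrite /N asboolT// => psi1 psi2 K1 K2 V1 V2.
  have [?|/Qr|/Qr] := QV psi1 psi2 K1 K2 V1 V2; [exact: Or31| |].
    by rewrite -childE => ?; exact: Or32.
  by rewrite -childE => ?; exact: Or33.
exists N; split.
  by move=> [psi Kpsi nN]; have [V [NV]] := remN _ _ (rem _ Kpsi); exact: nN.
move=> sgV; rewrite {1 2}/N; case: asboolP => [OV|_]; [right|by left].
exists (c sgV); split=> // -[m d] [psi /= [Kpsi Vpsi nN [m1 dm]]].
have := cP sgV OV psi Kpsi (inhs_margin_gt0 (eps_gt0 R d) Vpsi).
case=> [[sg' sgc /remN[V' [NV' V'psi]]]|/(_ m m1)]; first exact: nN sgc NV' V'psi.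
by have := eps_gt0 R d; lra.
Qed.

End existence.

Section definability.
Variables (y : baire -> nat -> C2N R) (ph : baire -> nat -> nat -> R).
Variable (N : baire -> seq tnode * halfspaces -> nat).
Hypothesis yc : forall u z n, bcvg u z -> y (u i) n @[i --> \oo] --> y z n.
Hypothesis phc : forall u z n m, bcvg u z ->
  ph (u i) n m @[i --> \oo] --> (ph z n m : R).
Hypothesis Nc : forall u z sgV, bcvg u z -> \forall i \near \oo, N (u i) sgV = N z sgV.

Let not_inhs_limit (G : set_system nat) (psi : nat -> nat -> R) l u z sgV :
  bcvg u z -> ProperFilter G -> \oo `<=` G ->
  (forall m, psi n m @[n --> G] --> (l m : R)) ->
  (forall n, N (u n) sgV <> 0%N -> ~ inhs sgV.2 (psi n)) ->
  N z sgV <> 0%N -> ~ inhs sgV.2 l.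
Proof.
move=> uz PG oG psil nV Nz /(inhs_limit PG psil) GV.
have GN : G [set i | N (u i) sgV = N z sgV] by apply: oG; exact: Nc.
have [n [Vn Nn]] := filter_ex (filterI GV GN).
by apply: (nV n) Vn; rewrite Nn.
Qed.

Lemma uncovered_root_closed : bclosed [set z | uncovered_root (y z) (N z)].
Proof.
move=> u z uz Hu.
have /choice[psi psiP] : forall n, exists psi, dual_ball k (y (u n)) psi /\
    forall V, N (u n) ([::], V) <> 0%N -> ~ inhs V psi.
  by move=> n; have [psi] := Hu n; exists psi.
have [|n|G [PG oG [l lK psil]]] :=
    @dual_ball_limit R k (fun n => y (u n)) (y z) psi _.
- by move=> m; exact: yc.
- exact: (psiP n).1.
exists l => // V; apply: (@not_inhs_limit G psi l u z ([::], V)) => // n.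
exact: (psiP n).2.
Qed.

Lemma uncovered_cell_closed sg V n m d :
  bclosed [set z | uncovered_cell (y z) (N z) sg V (ph z n) m d].
Proof.
move=> u z uz Hu; have [psi psiP] := choice Hu.
have [|i|G [PG oG [l lK psil]]] :=
    @dual_ball_limit R k (fun n => y (u n)) (y z) psi _.
- by move=> j; exact: yc.
- by have [] := psiP i.
exists l; split=> //.
- apply: (inhs_margin_limit PG psil).
  by apply: oG; exists 0%N => // i _; have [] := psiP i.
- move=> sg' V' c; apply: (@not_inhs_limit G psi l u z (sg', V')) => // i.
  by have [_ _ + _] := psiP i; exact.
split.
  apply: (@cvgr_to_le _ \oo _ _ _ _ _ (cvg_norm (@yc _ _ m uz))).
  by exists 0%N => // i _; have [_ _ _ []] := psiP i.
have phG : ph (u i) n m @[i --> G] --> (ph z n m : R).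
  by move=> A /(@phc _ _ n m uz)/oG.
apply: (@cvgr_to_ge _ G _ _ _ _ _ (cvg_norm (cvgB (psil m) phG))).
by apply: oG; exists 0%N => // i _; have [_ _ _ []] := psiP i.
Qed.

Lemma covering_analytic : banalytic [set z | covering (y z) (ph z) (N z)].
Proof.
have Ncst sgV j : bclosed [set z | N z sgV = j].
  move=> u z uz Nu; have [i _ iN] := @Nc _ _ sgV uz.
  have := iN i (leqnn _) => /= {}iN; rewrite /= -iN; exact: Nu.
apply: banalytic_and.
  by apply: bopen_analytic; rewrite setCK; exact: uncovered_root_closed.
apply: banalytic_all => sgV; apply: banalytic_or.
  exact: bclosed_analytic (Ncst sgV 0%N).
apply: banalytic_ex => n; apply: banalytic_and.
  exact: bclosed_analytic (Ncst sgV n.+1).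
apply: (@banalytic_all (nat * nat)%type) => md; apply: bopen_analytic.
rewrite setCK; exact: uncovered_cell_closed.
Qed.

End definability.
End cover.

(** * Presentations of spaces isomorphic to a dual *)

Section normed_facts.
Variables (R : realType) (U V : normedModType R).

Lemma linear_cts_bound (h : U -> V) : linear h -> continuous h ->
  exists C : nat, forall u, `|h u| <= C%:R * `|u|.
Proof.
move=> hl hc.
pose l := GRing.isLinear.Build R U V *:%R h hl.
pose H : {linear U -> V} := HB.pack h l.
have Hc : continuous H by exact: hc.
move: Hc => /(_ 0)/continuous_linear_bounded/linear_boundedP[M [_ hM]].
have [C MC] : exists C : nat, M < C%:R.
  exists (Num.bound `|M|); apply: le_lt_trans (ler_norm _) _.
  exact: archi_boundP.
by exists C => u; exact: hM.
Qed.

End normed_facts.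

Lemma subspace_dense_seq (R : realType) (X : closedSubspace (C2N R)) :
  exists x : nat -> C2N R, (X : set _) = closure (range x).
Proof.
have [e ed] := C2N_dense_seq R.
have X0 : (X : set _) 0 by have [+ _] := subspace_submod X; rewrite inE.
(* The default 0 is harmless, since it belongs to [X]. *)
pose x n := if unpickle n is Some (i, j) then
  xget 0 ((X : set _) `&` ball (e i) (eps R j)) else 0.
have xX n : (X : set _) (x n).
  by rewrite /x; case: unpickle => // -[i j]; case: xgetP => // y _ [].
exists x; apply/seteqP; split.
  apply: (meets_sub ed) => i j [y Xy]; exists (x (pickle (i, j))); split; first by exists (pickle (i, j)).
  by rewrite /x pickleK; case: xgetP => [z _ []//|/(_ y)].
rewrite [X in _ `<=` X](iffLR (closure_id _) (@subspace_closed _ _ X)).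
by apply: closure_subset => _ [n _ <-].
Qed.

Section isomorphism_codes.
Variables (R : realType) (X : closedSubspace (C2N R)) (x : nat -> C2N R).
Hypothesis Xx : (X : set _) = closure (range x).
Local Notation X' := (dual (subspace_space X)).

(** The map from [ph n] to [y n] is bounded above and below by [M], without naming the dual norm:
    the upper bound tests the norm at a single entry of [x], the lower one bounds it at all entries.
    Combinations occur in the first clause because it must feed [dense_extension]. *)
Definition dual_equiv (y : nat -> C2N R) (ph : nat -> nat -> R) (M : nat) :=
  (forall i j l (c : rat), exists m, `|x m| <= 1 /\
    `|y i + ratr c *: y j - y l| <= M%:R * `|ph i m + ratr c * ph j m - ph l m|) /\
  (forall i l m, `|ph i m - ph l m| <= M%:R * `|x m| * `|y i - y l|).

Section realization.
Variables (y : nat -> C2N R) (ph : nat -> nat -> R) (M : nat).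
Hypothesis phx : forall n, exists k, dual_ball k x (ph n).
Hypothesis phd : forall k psi, dual_ball k x psi ->
  exists n, unit_close x (2 * ratr (gap k)) psi (ph n).
Hypothesis yph : dual_equiv y ph M.

Let realize_ex : exists (T : X' -> C2N R) (f : nat -> X'), [/\ linear T,
  forall n, T (f n) = y n, dense_seq f,
  forall u, `|T u| <= M%:R * `|u| & forall u, `|u| <= M%:R * `|T u|].
Proof.
have [xs [xsE xsd]] := dense_subspace_seq Xx.
have /choice[f fE] : forall n, exists f : X', forall m, f (xs m) = ph n m.
  by move=> n; have [k phK] := phx n; exact: (dual_ball_ex xsE xsd phK).
have xsn m : `|xs m| = `|x m| by rewrite subspace_normE xsE.
have fd : dense_seq f.
  move=> u d d0.
  have [k [uk kd]] : exists k, `|u| <= k%:R /\ 2 * ratr (gap k) < d.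
    (* This [k] exceeds both the norm of [u] and [2 / d], so the ball contains [u] and the error
       [2 / (k + 1)] is below [d]. *)
    pose k := Num.bound (`|u| + 2 / d).
    have kb : `|u| + 2 / d < k%:R by apply: archi_boundP; rewrite addr_ge0// divr_ge0// ltW.
    have d2 : 0 < 2 / d by rewrite divr_gt0.
    exists k; split; first by have := normr_ge0 u; lra.
    rewrite /gap fmorphV rmorph_nat ltr_pdivrMr ?ltr0n// mulrC -ltr_pdivrMr//.
    rewrite (le_lt_trans _ (lt_le_trans kb _)) ?ler_nat//.
    by rewrite lerDr.
  have [n nc] := phd (dual_ball_dual xsE uk).
  exists n; apply: le_lt_trans kd; apply: (dual_norm_le_dense xsd) => m m1.
  rewrite [X in `|X|](_ : _ = dual_fun u (xs m) - f n (xs m))// fE.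
  by apply: nc; rewrite -xsn.
have [yub ylb] := yph.
have [|T [Tl Tf TM]] := @dense_extension R X' (C2N R) f y M%:R
    (@C2N_fast_complete R) fd (ler0n _ _).
  move=> i j l c; have [m [m1]] := yub i j l c; move/le_trans; apply.
  rewrite ler_wpM2l// -!fE.
  apply: le_trans (dual_norm_ge (f i + ratr c *: f j - f l) (xs m)) _.
  by rewrite ler_piMr// xsn.
exists T, f; split=> // u.
have flb i l : `|f i - f l| <= M%:R * `|y i - y l|.
  apply: (dual_norm_le_dense xsd) => m m1.
  rewrite [X in `|X|](_ : _ = f i (xs m) - f l (xs m))// !fE.
  rewrite (le_trans (ylb i l m))// -xsn mulrAC ler_piMr// mulr_ge0//.
have TB := linear_subr Tl.
have Tc : continuous T.
  by apply: (@lipschitz_cts _ _ _ _ M%:R) => a b; rewrite TB.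
have [s su] := dense_seq_cvg u fd; have [t t0] := dense_seq_cvg 0 fd.
have T0 : T 0 = 0 by have := TB 0 0; rewrite !subrr => /esym.
rewrite -[u in leLHS]subr0 -[T u]subr0 -T0.
apply: (@ler_cvg_to _ \oo _ R (fun k => `|f (s k) - f (t k)|)
   (fun k => M%:R * `|T (f (s k)) - T (f (t k))|)).
- by apply: cvg_norm; exact: cvgB.
- apply: cvgMl_tmp; apply: cvg_norm; apply: cvgB; apply: continuous_cvg => //; exact: Tc.
- by apply: nearW => k; rewrite !Tf.
Qed.

(** Being bounded below on a complete space, [T] has closed range; [fast_lipschitz_cvg] is applied
    to its inverse. *)
Lemma dual_iso_realized : exists2 Y : closedSubspace (C2N R),
  (Y : set _) = closure (range y) & isomorphic (subspace_space Y) X'.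
Proof.
have [T [f [Tl Tf fd TM MT]]] := realize_ex.
have TB := linear_subr Tl.
have Tc : continuous T.
  by apply: (@lipschitz_cts _ _ _ _ M%:R) => a b; rewrite TB.
have Tinj : injective T.
  move=> a b ab; apply/eqP; rewrite -subr_eq0 -normr_le0.
  by rewrite (le_trans (MT _))// -TB ab subrr normr0 mulr0.
have Tcl : closed (range T).
  move=> p /closure_ballP pT.
  have M1 : 0 < 2 * (M%:R + 1) :> R by rewrite mulr_gt0// ltr_wpDl.
  have /choice[u uP] : forall k, exists u : X', `|p - T u| < eps R k / (2 * (M%:R + 1)).
    move=> k; have [_ [u _ <-]] := pT _ (divr_gt0 (eps_gt0 R k) M1).
    by rewrite -ball_normE => pu; exists u.
  have uS k : `|u k - u k.+1| <= M%:R * `|T (u k) - T (u k.+1)|.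
    by rewrite TB; exact: MT.
  have [Tup [w uw]] := fast_lipschitz_cvg (@dual_fast_complete R _) (ler0n R M) uP uS.
  exists w => //.
  have Tuw : T (u k) @[k --> \oo] --> T w by apply: continuous_cvg => //; exact: Tc.
  by rewrite -(cvg_lim (@norm_hausdorff _ _) Tup) (cvg_lim (@norm_hausdorff _ _) Tuw).
have T0 : T 0 = 0 by have := TB 0 0; rewrite !subrr => /esym.
have Tsm : submod_closed (mem (range T)).
  split; first by rewrite inE; exists 0.
  move=> a _ _ /set_mem[u _ <-] /set_mem[w _ <-]; rewrite inE.
  by exists (a *: u + w) => //; rewrite Tl.
pose Y := ClosedSubspace Tcl Tsm.
exists Y.
  apply/seteqP; split=> /=; last first.
    rewrite [X in _ `<=` X](iffLR (closure_id _) Tcl).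
    by apply: closure_subset => _ [n _ <-]; exists (f n).
  move=> _ [u _ <-]; have [s su] := dense_seq_cvg u fd.
  have Ts : T (f (s k)) @[k --> \oo] --> T u by apply: continuous_cvg => //; exact: Tc.
  apply: (@closed_cvg _ _ _ _ _ (closure (range y))) Ts; first exact: closed_closure.
  by apply: nearW => k; rewrite Tf; apply: subset_closure; exists (s k).
have TY u : T u \in subspace_pred Y by rewrite inE; exists u.
pose g u : subspace_space Y := exist _ (T u) (TY u).
have /choice[h hP] : forall p : subspace_space Y, exists u, T u = val p.
  by move=> p; have := valP p; rewrite inE => -[u _ up]; exists u.
have hl : linear h.
  by move=> a p q; apply: Tinj; rewrite Tl !hP.
pose l := GRing.isLinear.Build R (subspace_space Y) X' *:%R h hl.
pose H : {linear subspace_space Y -> X'} := HB.pack h l.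
exists H, g; split.
- by move=> p; apply: val_inj; exact: hP.
- by move=> u; apply: Tinj; exact: hP.
- apply: (@lipschitz_cts _ _ _ _ M%:R) => p q.
  by rewrite (le_trans (MT _))// -TB !hP.
- apply: (@lipschitz_cts _ _ _ _ M%:R) => u w.
  by rewrite [leLHS](_ : _ = `|T u - T w|)// TB; exact: TM.
Qed.

End realization.

Lemma dual_iso_codes (Y : closedSubspace (C2N R)) :
  separable X' -> isomorphic (subspace_space Y) X' ->
  exists (y : nat -> C2N R) (ph : nat -> nat -> R) (M : nat),
  [/\ (Y : set _) = closure (range y), forall n, exists k, dual_ball k x (ph n),
      forall k psi, dual_ball k x psi ->
        exists n, unit_close x (ratr (gap k)) psi (ph n) &
      dual_equiv y ph M].
Proof.
move=> /(separable_seq 0)[e' e'd] [f [g [fK gK fc gc]]].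
pose e : nat -> X' := e'.
have ed (p : X') d : 0 < d -> exists n, ball p d (e n) by exact: e'd.
have [xs [xsE xsd]] := dense_subspace_seq Xx.
have xsn m : `|xs m| = `|x m| by rewrite subspace_normE xsE.
have gl : linear g.
  by move=> a u w; apply: (can_inj fK); rewrite linearP !gK.
have [Cf Cfb] := linear_cts_bound (linearP f) fc.
have [Cg Cgb] := linear_cts_bound gl gc.
have eD : dense_seq e.
  by move=> u d d0; have [n] := ed u d d0; rewrite -ball_normE; exists n.
(* [Cf] bounds the functionals by their images under [g]; [Cg] bounds [g], doubled by the factor
   lost in [dual_norm_attain]. *)
exists (fun n => val (g (e n))), (fun n m => e n (xs m)), (Cf + 2 * Cg)%N.
split.
- apply/seteqP; split; last first.
    rewrite [X in _ `<=` X](iffLR (closure_id _) (@subspace_closed _ _ Y)).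
    by apply: closure_subset => _ [n _ <-]; have := valP (g (e n)); rewrite inE.
  move=> p Yp; have pY : p \in subspace_pred Y by rewrite inE.
  pose p' : subspace_space Y := exist _ p pY.
  have [s sp] := dense_seq_cvg (f p') eD.
  have gs : g (e (s k)) @[k --> \oo] --> p'.
    by rewrite -(fK p'); apply: continuous_cvg => //; exact: gc.
  apply/closure_ballP => d d0; have /cvgrPdist_lt/(_ d d0)/filter_ex[k kd] := gs.
  exists (val (g (e (s k)))); first by exists (s k).
  by rewrite -ball_normE.
- move=> n; exists (Num.bound `|e n|); apply: (dual_ball_dual xsE).
  exact/ltW/archi_boundP.
- move=> k psi /(dual_ball_ex xsE xsd)[h hE].
  have [n hn] := eD h _ (gap_gt0 R k).
  exists n => m m1; rewrite -hE.
  apply: le_trans (dual_norm_ge (h - e n) (xs m)) _.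
  by rewrite xsn (le_trans _ (ltW hn))// ler_piMr.
split=> [i j l c|i l m].
  pose E := e i + ratr c *: e j - e l.
  have [m [m1 Em]] := dual_norm_attain xsd E.
  exists m; split; first by rewrite -xsn.
  have -> : val (g (e i)) + ratr c *: val (g (e j)) - val (g (e l)) = val (g E).
    have -> : E = -1 *: e l + (ratr c *: e j + e i).
      by rewrite /E scaleN1r addrC (addrC (e i)).
    by rewrite !gl !linearE /= scaleN1r addrC (addrC (ratr c *: _)).
  rewrite -subspace_normE (le_trans (Cgb E))//.
  rewrite natrD natrM mulrDl ler_wpDl ?mulr_ge0//.
  by rewrite [2 * _]mulrC -mulrA ler_wpM2l.
apply: le_trans (dual_norm_ge (e i - e l) (xs m)) _.
rewrite -xsn -mulrA mulrCA mulrC ler_wpM2l//.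
have -> : e i - e l = f (g (e i) - g (e l)) by rewrite linearB !gK.
rewrite (le_trans (Cfb _))// subspace_normE raddfB.
by rewrite natrD mulrDl lerDl mulr_ge0.
Qed.

End isomorphism_codes.

(** * Codes of real arrays, and definability of the conditions on them *)

Section real_codes.
Variable R : realType.

Lemma real_dense_seq : exists e : nat -> R, forall p d, 0 < d -> exists n, ball p d (e n).
Proof.
exists (fun n => if unpickle n is Some q then ratr q else 0) => p d d0.
have [q] := @rat_in_itvoo R (p - d) (p + d) ltac:(lra).
rewrite in_itv /= => /andP[q1 q2]; exists (pickle q); rewrite pickleK.
by rewrite -ball_normE /= ltr_distl; apply/andP; split; lra.
Qed.

Variable e : nat -> R.

Definition rarray (z : baire) (n m : nat) : R :=
  brep e (@real_fast_complete R) (bsub (bsub z n) m).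

Lemma rarray_cvg u z n m : bcvg u z -> rarray (u k) n m @[k --> \oo] --> rarray z n m.
Proof. by move=> uz; apply: brep_cvg; apply: bcvg_sub; exact: bcvg_sub. Qed.

Lemma rarray_surj (ph : nat -> nat -> R) :
  (forall p d, 0 < d -> exists n, ball p d (e n)) ->
  exists z, forall n m, rarray z n m = ph n m.
Proof.
move=> ed.
have /choice[f fP] : forall n, exists z, forall m,
    brep e (@real_fast_complete R) (bsub z m) = ph n m.
  move=> n; have /choice[f fP] m :=
    brep_surj (@real_fast_complete R) (@Rhausdorff R) ed (ph n m).
  by have [z zP] := bsub_ex f; exists z => m; rewrite zP.
by have [z zP] := bsub_ex f; exists z => n m; rewrite /rarray zP.
Qed.

Lemma bclosed_le (a b : baire -> R) :
  (forall u z, bcvg u z -> a (u n) @[n --> \oo] --> a z) ->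
  (forall u z, bcvg u z -> b (u n) @[n --> \oo] --> b z) ->
  bclosed [set z | a z <= b z].
Proof.
move=> ac bc u z uz ab; apply: (@ler_cvg_to _ \oo _ R _ _ _ _ (ac u z uz) (bc u z uz)).
exact: nearW.
Qed.

End real_codes.

Lemma bclosed_all (I : Type) (P : I -> set baire) :
  (forall i, bclosed (P i)) -> bclosed [set z | forall i, P i z].
Proof. by move=> Pc u z uz Pu i; apply: (Pc i u) => // n; exact: Pu. Qed.

Section definability.
Variables (R : realType) (x y : baire -> nat -> C2N R) (ph : baire -> nat -> nat -> R).
Hypothesis xc : forall u z n, bcvg u z -> x (u i) n @[i --> \oo] --> x z n.
Hypothesis yc : forall u z n, bcvg u z -> y (u i) n @[i --> \oo] --> y z n.
Hypothesis phc : forall u z n m, bcvg u z ->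
  ph (u i) n m @[i --> \oo] --> (ph z n m : R).

Let comb_cvg (w : baire -> nat -> C2N R) (c : R) i j l u z :
  (forall u z n, bcvg u z -> w (u i) n @[i --> \oo] --> w z n) -> bcvg u z ->
  `|w (u n) i + c *: w (u n) j - w (u n) l| @[n --> \oo] -->
  `|w z i + c *: w z j - w z l|.
Proof.
move=> wc uz; apply: cvg_norm; apply: cvgB; last exact: wc.
by apply: cvgD; [exact: wc|apply: cvgZl_tmp; exact: wc].
Qed.

Let phcomb_cvg (c : R) i j l m m' m'' u z : bcvg u z ->
  `|ph (u n) i m + c * ph (u n) j m' - ph (u n) l m''| @[n --> \oo] -->
  `|ph z i m + c * ph z j m' - ph z l m''|.
Proof.
move=> uz; apply: cvg_norm; apply: cvgB; last exact: phc.
by apply: cvgD; [exact: phc|apply: cvgMl_tmp; exact: phc].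
Qed.

Lemma dual_ball_closed k n : bclosed [set z | dual_ball k (x z) (ph z n)].
Proof.
do 3 (apply: bclosed_all => ?); apply: bclosed_all => c.
apply: bclosed_le => u z uz; first exact: phcomb_cvg.
by apply: cvgMl_tmp; exact: comb_cvg.
Qed.

Lemma dual_equiv_analytic M :
  banalytic [set z | dual_equiv (x z) (y z) (ph z) M].
Proof.
apply: banalytic_and.
  do 3 (apply: banalytic_all => ?); apply: banalytic_all => c.
  apply: banalytic_ex => m; apply: banalytic_and.
    apply: bclosed_analytic; apply: bclosed_le => u z uz; last exact: cvg_cst.
    by apply: cvg_norm; exact: xc.
  apply: bclosed_analytic; apply: bclosed_le => u z uz; first exact: comb_cvg.
  by apply: cvgMl_tmp; exact: phcomb_cvg.
apply: bclosed_analytic; apply: bclosed_all => i; apply: bclosed_all => l.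
apply: bclosed_all => m; apply: bclosed_le => u z uz.
  by apply: cvg_norm; apply: cvgB; exact: phc.
apply: cvgM; last by apply: cvg_norm; apply: cvgB; exact: yc.
by apply: cvgMl_tmp; apply: cvg_norm; exact: xc.
Qed.

End definability.

Theorem theorem1 (R : realType) (A : set (SB R)) :
  analytic R A ->
  (forall X : SB R, A X -> separable (dual (subspace_space X))) ->
  analytic R [set Y : SB R | exists2 X : SB R,
    A X & isomorphic (subspace_space Y) (dual (subspace_space X))].
Proof.
move=> Aan Asep.
have [e ed] := C2N_dense_seq R.
have [er erd] := real_dense_seq R.
have [F Fc FP] := codes_of_analytic ed Aan.
(* The set of codes is analytic only, so the tree approximates points of the closed set [F]: a code
   joined with a witness of its membership. *)
pose xv (v : baire) := cseq e (beven v).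
have xvc u z n : bcvg u z -> xv (u i) n @[i --> \oo] --> xv z n.
  by move=> uz; apply: cseq_cvg; exact: bcvg_even.
have FX v : F v -> exists2 X : SB R, A X & (X : set _) = closure (range (xv v)).
  by move=> Fv; apply/FP; exists (bodd v); rewrite bjoinK.
pose child k := achild F xv k.
(* Separability of the duals of all members of [A] is used here at once. *)
have wf k sg : Acc (child k) sg.
  apply: achild_wf => // v lab /FX[X AX Xv].
  exact: separable_dual_no_branch Xv (Asep X AX).
(* The slices of [z] hold a point of [F], a dense sequence of [Y], the functionals matching it, and
   one certificate for each [k]. *)
pose x z := xv (bsub z 0).
pose y z := cseq e (bsub z 1).
pose ph z := rarray er (bsub z 2).
pose N k z (sgV : seq tnode * halfspaces) := bsub (bsub z 3) k (pickle sgV).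
have xc u z n : bcvg u z -> x (u i) n @[i --> \oo] --> x z n.
  by move=> uz; apply: xvc; exact: bcvg_sub.
have yc u z n : bcvg u z -> y (u i) n @[i --> \oo] --> y z n.
  by move=> uz; apply: cseq_cvg; exact: bcvg_sub.
have phc u z n m : bcvg u z -> ph (u i) n m @[i --> \oo] --> ph z n m.
  by move=> uz; apply: rarray_cvg; exact: bcvg_sub.
have Nc k u z sgV : bcvg u z -> \forall i \near \oo, N k (u i) sgV = N k z sgV.
  by move=> uz; exact: (bcvg_sub k (bcvg_sub 3 uz)).
pose P := [set z | F (bsub z 0) /\ (forall n, exists k, dual_ball k (x z) (ph z n)) /\
  (forall k, covering k (child k) (x z) (ph z) (N k z)) /\
  exists M, dual_equiv (x z) (y z) (ph z) M].
apply: (@analytic_of_codes R _ P y).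
- apply: banalytic_and.
    by apply: bclosed_analytic => u z uz; apply: Fc; exact: bcvg_sub.
  apply: banalytic_and.
    apply: banalytic_all => n; apply: banalytic_ex => k.
    by apply: bclosed_analytic; exact: dual_ball_closed.
  apply: banalytic_and.
    apply: banalytic_all => k.
    exact: (covering_analytic k (child k) xc phc (Nc k)).
  by apply: banalytic_ex => M; exact: dual_equiv_analytic.
- exact: yc.
- move=> z [/FX[X AX Xx] [phx [cov [M yph]]]].
  have [|Y Yy YX] := dual_iso_realized Xx phx _ yph.
    by move=> k psi; exact: (covering_close (wf k) (cov k)).
  by exists Y => //; exists X.
move=> Y [X AX YX].
have [x0 Xx0] := subspace_dense_seq X.
have [z0 z0E] := cseq_surj ed x0.
have [w Fw] : exists w, F (bjoin z0 w).
  by apply/FP; exists X => //; rewrite Xx0 (funext z0E).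
pose v := bjoin z0 w.
have Xv : (X : set _) = closure (range (xv v)).
  by rewrite Xx0 /xv bevenK (funext z0E).
have [y0 [ph0 [M [Yy0 ph0x ph0d y0ph]]]] := dual_iso_codes Xv (Asep X AX) YX.
have [z1 z1E] := cseq_surj ed y0.
have [z2 z2E] := rarray_surj ph0 erd.
have /choice[N0 N0P] : forall k, exists N0, covering k (child k) (xv v) ph0 N0.
  move=> k; apply: (covering_ex (F := F)) (ph0d k) => // psi.
  exact: removed_all Fw (wf k) psi.
have [z3 z3E] := bsub_ex (fun k j => if unpickle j is Some sgV then N0 k sgV else 0%N).
have [z zE] := bsub_ex (nth (fun=> 0%N) [:: v; z1; z2; z3]).
have z0v : bsub z 0 = v by rewrite zE.
have xE : x z = xv v by rewrite /x z0v.
have yE : y z = y0 by apply/funext => n; rewrite /y zE z1E.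
have phE : ph z = ph0 by apply/funext => n; apply/funext => m; rewrite /ph zE z2E.
have NE k : N k z = N0 k by apply/funext => sgV; rewrite /N zE /= z3E pickleK.
exists z; last by rewrite yE.
split; first by rewrite z0v.
split; first by rewrite xE phE.
split; last by exists M; rewrite xE yE phE.
by move=> k; rewrite xE phE NE.
Qed.
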